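(* Let $G$ be a compact group and $\alpha$ an automorphism of $G$ such that the pair $(G,\alpha)$ is topologically transitive and has finite depth. Then $(G,\alpha)$ has a composition series, and any two composition series for $(G,\alpha)$ are equivalent.
   Context: All groups are Hausdorff topological groups and automorphisms are automorphisms of topological groups. A subgroup $H$ is $\alpha$-stable if $\alpha(H)=H$. A pair $(K,\beta)$ with $K$ compact and $\beta\in\mathrm{Aut}(K)$ is topologically transitive if there is $x\in K$ whose orbit $\{\beta^n(x):n\in\mathbb{Z}\}$ is dense in $K$; a closed $\alpha$-stable subgroup $H$ is topologically transitive if $(H,\alpha|_H)$ is. $(G,\alpha)$ has finite depth if there is an open subgroup $V\le G$ with $\bigcap_{k\in\mathbb{Z}}\alpha^k(V)=\{1\}$. A subnormal series for $(G,\alpha)$ is a sequence $\{1\}=G_0\le G_1\le\cdots\le G_r=G$ of closed, $\alpha$-stable, topologically transitive subgroups such that for each $j$, $G_{j-1}$ is normal in $G_j$ and the induced automorphism $\alpha_j$ of $G_j/G_{j-1}$ is topologically transitive; the pairs $(G_j/G_{j-1},\alpha_j)$ are the subquotients. A pair $(K,\beta)$ with $K$ compact and infinite is irreducible if every proper, closed, normal, $\beta$-stable subgroup of $K$ is finite. A composition series is a subnormal series all of whose subquotients are irreducible. Two pairs $(G_1,\alpha_1)$, $(G_2,\alpha_2)$ are co-commensurable if there is a compact group $H$ with automorphism $\beta$ and surjective continuous homomorphisms $\varphi_i:H\to G_i$ with finite kernels and $\varphi_i\circ\beta=\alpha_i\circ\varphi_i$ ($i=1,2$). Two subnormal series $(G_j)_{j=0}^r$,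 $(H_j)_{j=0}^s$ are equivalent if $r=s$ and there is a permutation $\pi$ of $\{1,\dots,r\}$ such that $(G_j/G_{j-1},\alpha_j)$ is co-commensurable with $(H_{\pi(j)}/H_{\pi(j)-1},\alpha'_{\pi(j)})$ for each $j$ (with $\alpha'_i$ the induced automorphism on $H_i/H_{i-1}$). *)

(* Defs.v *)
From Stdlib Require Import ClassicalEpsilon List.
From mathcomp Require Import all_boot all_fingroup.

Set Implicit Arguments.
Unset Strict Implicit.
Unset Printing Implicit Defensive.

Record tgroup := TGroup {
  tcar :> Type;
  tmul : tcar -> tcar -> tcar;
  tone : tcar;
  tinv : tcar -> tcar;
  topen : (tcar -> Prop) -> Prop }.

Section Basics.
Variable G : tgroup.
Local Notation "x * y" := (@tmul G x y).
Local Notation "x ^-1" := (@tinv G x).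
Local Notation topen := (@topen G).
Local Notation "1" := (tone G).

Definition tclosed (A : G -> Prop) : Prop := topen (fun x => ~ A x).

Definition sfinite (A : G -> Prop) : Prop :=
  exists l : list G, forall x, A x -> In x l.

Definition is_topgroup : Prop :=
  (forall x y z, x * (y * z) = (x * y) * z) /\
  (forall x, 1 * x = x) /\
  (forall x, x^-1 * x = 1) /\
  topen (fun _ => True) /\
  (forall U V, topen U -> topen V -> topen (fun x => U x /\ V x)) /\
  (forall F : (G -> Prop) -> Prop, (forall U, F U -> topen U) ->
      topen (fun x => exists U, F U /\ U x)) /\
  (forall W x y, topen W -> W (x * y^-1) ->
      exists U V, topen U /\ topen V /\ U x /\ V y /\
        forall u v, U u -> V v -> W (u * v^-1)).

Definition hausdorff : Prop :=
  forall x y, x <> y -> exists U V, topen U /\ topen V /\ U x /\ V y /\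
    forall z, ~ (U z /\ V z).

Definition tcompact : Prop :=
  forall F : (G -> Prop) -> Prop, (forall U, F U -> topen U) ->
    (forall x, exists U, F U /\ U x) ->
    exists l : list (G -> Prop), (forall U, In U l -> F U) /\
      forall x, exists U, In U l /\ U x.

Definition subgrp (K : G -> Prop) : Prop :=
  K 1 /\ (forall x y, K x -> K y -> K (x * y)) /\ (forall x, K x -> K (x^-1)).

Definition closed_subgroup (K : G -> Prop) : Prop := subgrp K /\ tclosed K.

Definition normal_in (N K : G -> Prop) : Prop :=
  (forall x, N x -> K x) /\ forall k n, K k -> N n -> N (k^-1 * n * k).

Definition stable (a : G -> G) (H : G -> Prop) : Prop :=
  (forall x, H x -> H (a x)) /\ (forall y, H y -> exists x, H x /\ a x = y).

Definition hom (a : G -> G) : Prop := forall x y, a (x * y) = a x * a y.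
Definition tcontinuous (a : G -> G) : Prop :=
  forall U, topen U -> topen (fun x => U (a x)).

Definition is_aut (a : G -> G) : Prop :=
  hom a /\ tcontinuous a /\
  exists b : G -> G, cancel a b /\ cancel b a /\ tcontinuous b.

(* y lies in the Z-orbit {a^n x : n in Z} of x (a is bijective) *)
Definition orbit (a : G -> G) (x y : G) : Prop :=
  exists n : nat, iter n a x = y \/ iter n a y = x.

Definition topo_transitive (a : G -> G) : Prop :=
  exists x, forall U, topen U -> (exists y, U y) ->
    exists z, orbit a x z /\ U z.

Definition topo_transitive_sub (a : G -> G) (H : G -> Prop) : Prop :=
  exists x, H x /\ forall U, topen U -> (exists y, H y /\ U y) ->
    exists z, orbit a x z /\ H z /\ U z.

(* finite depth: an open subgroup V with  \bigcap_{k in Z} a^k(V) = {1} *)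
Definition finite_depth (a : G -> G) : Prop :=
  exists V, subgrp V /\ topen V /\
    forall x, (forall n : nat, exists v, V v /\ iter n a v = x) ->
              (forall n : nat, V (iter n a x)) -> x = 1.

Definition irreducible (b : G -> G) : Prop :=
  tcompact /\ ~ sfinite (fun _ => True) /\
  forall L, closed_subgroup L -> normal_in L (fun _ => True) -> stable b L ->
    (exists x, ~ L x) -> sfinite L.

End Basics.

(* Quotient K/N of a subgroup K of G by N (N normal in K), as a tgroup:
   elements are the cosets xN (x in K); quotient of the subspace topology.  *)
Section Quotient.
Variables (G : tgroup) (K N : G -> Prop) (hK : subgrp K).

Definition coset (x : G) : G -> Prop := fun y => N (tmul (tinv x) y).

Definition qcar := {A : G -> Prop | exists x, K x /\ A = coset x}.

Definition qrep (q : qcar) : G :=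
  proj1_sig (constructive_indefinite_description _ (proj2_sig q)).

Lemma qrep_in (q : qcar) : K (qrep q).
Proof.
by rewrite /qrep; case: (constructive_indefinite_description _ _) => x [].
Qed.

Definition qmk (x : G) (hx : K x) : qcar :=
  exist _ (coset x) (ex_intro _ x (conj hx erefl)).

Definition qmul (q r : qcar) : qcar :=
  qmk (proj1 (proj2 hK) _ _ (qrep_in q) (qrep_in r)).
Definition qone : qcar := qmk (proj1 hK).
Definition qinv (q : qcar) : qcar := qmk (proj2 (proj2 hK) _ (qrep_in q)).
Definition qopen (S : qcar -> Prop) : Prop :=
  exists U, topen U /\
    forall y, K y -> ((exists q, S q /\ proj1_sig q = coset y) <-> U y).

Definition quot : tgroup := TGroup qmul qone qinv qopen.

Definition qaut (a : G -> G) (hS : forall x, K x -> K (a x)) : quot -> quot :=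
  fun q => qmk (hS _ (qrep_in q)).

End Quotient.
Arguments quot {G K} N hK.
Arguments qaut {G K} N hK {a} hS.

Section Series.
Variables (G : tgroup) (a : G -> G).

Definition subnormal_series (r : nat) (Gs : nat -> G -> Prop) : Prop :=
  (forall x, Gs 0 x <-> x = tone G) /\ (forall x, Gs r x) /\
  (forall j, j <= r ->
     closed_subgroup (Gs j) /\ stable a (Gs j) /\ topo_transitive_sub a (Gs j)) /\
  (forall j, 0 < j <= r ->
     normal_in (Gs j.-1) (Gs j) /\
     forall (hK : subgrp (Gs j)) (hS : forall x, Gs j x -> Gs j (a x)),
       topo_transitive (qaut (Gs j.-1) hK hS)).

Definition composition_series (r : nat) (Gs : nat -> G -> Prop) : Prop :=
  subnormal_series r Gs /\
  forall j, 0 < j <= r ->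
    forall (hK : subgrp (Gs j)) (hS : forall x, Gs j x -> Gs j (a x)),
      irreducible (qaut (Gs j.-1) hK hS).

End Series.

Definition cocommensurable (G1 : tgroup) (a1 : G1 -> G1)
    (G2 : tgroup) (a2 : G2 -> G2) : Prop :=
  exists H : tgroup, is_topgroup H /\ hausdorff H /\ tcompact H /\
  exists b : H -> H, is_aut b /\
  exists (f1 : H -> G1) (f2 : H -> G2),
    (forall x y, f1 (tmul x y) = tmul (f1 x) (f1 y)) /\
    (forall U, topen U -> topen (fun x => U (f1 x))) /\
    (forall y, exists x, f1 x = y) /\
    sfinite (fun x => f1 x = tone G1) /\
    (forall h, f1 (b h) = a1 (f1 h)) /\
    (forall x y, f2 (tmul x y) = tmul (f2 x) (f2 y)) /\
    (forall U, topen U -> topen (fun x => U (f2 x))) /\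
    (forall y, exists x, f2 x = y) /\
    sfinite (fun x => f2 x = tone G2) /\
    (forall h, f2 (b h) = a2 (f2 h)).

(* equivalence of two subnormal series: same length r = s and a permutation
   pi of {1..r} (here of 'I_r, index j standing for j+1) *)
Definition equivalent_series (G : tgroup) (a : G -> G)
    (r : nat) (Gs : nat -> G -> Prop) (s : nat) (Hs : nat -> G -> Prop) : Prop :=
  r = s /\
  exists pi : {perm 'I_r}, forall j : 'I_r,
    forall (hK : subgrp (Gs j.+1)) (hS : forall x, Gs j.+1 x -> Gs j.+1 (a x))
           (hK' : subgrp (Hs (pi j).+1))
           (hS' : forall x, Hs (pi j).+1 x -> Hs (pi j).+1 (a x)),
      cocommensurable (qaut (Gs j) hK hS) (qaut (Hs (pi j)) hK' hS').

(* Main.v *)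
(* Finite depth provides an open normal subgroup V whose translates under the
   powers of the automorphism a meet trivially, so the sets "the orbit stays in V
   during [-n, n]" form a neighbourhood base of 1 and G behaves like a group
   shift. A closed a-stable subgroup H is determined up to finite index by the
   first symbols of its points whose strict future (resp. strict past) stays in V;
   counting these symbols bounds the length of strict chains of topologically
   transitive subgroups. The closure H0 of the group of points of H contracted by
   a is open in H, topologically transitive, and normal in every group
   normalising H. In a chain of maximal length all factors are irreducible: a
   closed normal stable A violating this would allow inserting A0.

   For uniqueness, given two composition series (G_j), (H_i), irreducibility of
   G_j/G_(j-1) shows that the image of G_j \cap H_i in it jumps, as i grows, from
   finite to everything at a single index. This index relation is symmetric in
   the two series, hence a bijection, and (G_j \cap H_i)/(G_(j-1) \cap H_(i-1))
   surjects onto both matching factors with finite kernels. *)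
From mathcomp Require Import all_boot all_fingroup.
From Stdlib Require Import List.
From mathcomp.classical Require Import boolp.
Require Import Defs.

Set Implicit Arguments.
Unset Strict Implicit.
Unset Printing Implicit Defensive.

(** * Topological groups *)

Section GroupLaws.
Variable G : tgroup.
Hypothesis tg : is_topgroup G.
Local Notation "x * y" := (@tmul G x y).
Local Notation "x ^-1" := (@tinv G x).
Local Notation "1" := (tone G).

Lemma tmulA x y z : x * (y * z) = x * y * z.
Proof. by case: tg. Qed.

Lemma tmul1 x : 1 * x = x.
Proof. by case: tg => _ []. Qed.

Lemma tmulV x : x^-1 * x = 1.
Proof. by case: tg => _ [] _ []. Qed.

Lemma tmulKV x : x * x^-1 = 1.
Proof.
rewrite -(tmul1 (x * x^-1)) -{1}(tmulV (x^-1)) -!tmulA (tmulA (x^-1) x).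
by rewrite tmulV tmul1 tmulV.
Qed.

Lemma tmulx1 x : x * 1 = x.
Proof. by rewrite -(tmulV x) tmulA tmulKV tmul1. Qed.

Lemma tmulVK x y : x * y^-1 * y = x.
Proof. by rewrite -tmulA tmulV tmulx1. Qed.

Lemma tmulK x y : x * y * y^-1 = x.
Proof. by rewrite -tmulA tmulKV tmulx1. Qed.

Lemma tinv_uniq x y : x * y = 1 -> x = y^-1.
Proof. by move=> xy; rewrite -(tmulK x y) xy tmul1. Qed.

Lemma tinvK x : x^-1^-1 = x.
Proof. by rewrite -(tinv_uniq (tmulKV x)). Qed.

Lemma tinvM x y : (x * y)^-1 = y^-1 * x^-1.
Proof. by rewrite -(tinv_uniq (x := y^-1 * x^-1)) // tmulA tmulVK tmulV. Qed.

Lemma tinv1 : 1^-1 = 1.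
Proof. by rewrite -[RHS](tmulV 1) tmulx1. Qed.

Definition tgE :=
  (tmulA, tinvM, tinvK, tinv1, tmul1, tmulx1, tmulVK, tmulK, tmulV, tmulKV).

Lemma tmul_linj x y z : x * y = x * z -> y = z.
Proof. by move=> e; rewrite -(tmul1 y) -(tmul1 z) -(tmulV x) -!tmulA e. Qed.

Section Hom.
Variable f : G -> G.
Hypothesis fh : hom f.

Lemma hom1 : f 1 = 1.
Proof. by apply: (@tmul_linj (f 1)); rewrite -fh !tgE. Qed.

Lemma homV x : f (x^-1) = (f x)^-1.
Proof. by apply: tinv_uniq; rewrite -fh tmulV hom1. Qed.

Lemma iter_hom n : hom (iter n f).
Proof. by elim: n => // n IH x y /=; rewrite IH fh. Qed.

End Hom.

Section Subgroup.
Variables (K : G -> Prop) (sK : subgrp K).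

Lemma sub1 : K 1. Proof. by case: sK. Qed.
Lemma subM x y : K x -> K y -> K (x * y).
Proof. by case: sK => _ [h _]; apply: h. Qed.

Lemma subV x : K x -> K (x^-1). Proof. by case: sK => _ [_ h]; apply: h. Qed.

Lemma subVr x : K (x^-1) -> K x.
Proof. by move=> /subV; rewrite tinvK. Qed.

Lemma subMl x y : K x -> K (x^-1 * y) -> K y.
Proof. by move=> Kx /(subM Kx); rewrite !tgE. Qed.

Lemma sub_divC x y : K (x^-1 * y) -> K (y^-1 * x).
Proof. by move/subV; rewrite !tgE. Qed.

Lemma sub_div x y : K x -> K y -> K (x^-1 * y).
Proof. by move=> /subV; apply: subM. Qed.

Lemma sub_div_trans y x z : K (x^-1 * y) -> K (y^-1 * z) -> K (x^-1 * z).
Proof. by move=> xy yz; have := subM xy yz; rewrite !tgE. Qed.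

End Subgroup.

Lemma subgrpI (K L : G -> Prop) : subgrp K -> subgrp L ->
  subgrp (fun x => K x /\ L x).
Proof.
move=> sK sL; split; first by split; apply: sub1.
split=> [x y [Kx Lx] [Ky Ly]|x [Kx Lx]]; split;
  by [apply: subM | apply: subV].
Qed.

Lemma normalJ (N K : G -> Prop) : normal_in N K -> subgrp K ->
  forall k n, K k -> N n -> N (k * n * k^-1).
Proof.
by case=> _ NK sK k n Kk /(NK _ _ (subV sK Kk)); rewrite tinvK.
Qed.

End GroupLaws.

Section Topology.
Variable G : tgroup.
Hypothesis tg : is_topgroup G.
Local Notation "x * y" := (@tmul G x y).
Local Notation "x ^-1" := (@tinv G x).
Local Notation "1" := (tone G).
Implicit Types (U W A : G -> Prop).
Let tgE := tgE tg.

Lemma topen_ext U W : (forall x, U x <-> W x) -> topen U -> topen W.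
Proof. by move=> UW; suff -> : U = W by []; apply/predeqP. Qed.

Lemma topenT : topen (fun _ : G => True).
Proof. by case: tg => _ [_ [_ []]]. Qed.

Lemma topenI U W : topen U -> topen W -> topen (fun x => U x /\ W x).
Proof. by case: tg => _ [_ [_ [_ [h _]]]]; apply: h. Qed.

Lemma topen_bigU (F : (G -> Prop) -> Prop) : (forall U, F U -> topen U) ->
  topen (fun x => exists U, F U /\ U x).
Proof. by case: tg => _ [_ [_ [_ [_ [h _]]]]]; apply: h. Qed.

Lemma topen_div W x y : topen W -> W (x * y^-1) ->
  exists U V, topen U /\ topen V /\ U x /\ V y /\
    forall u v, U u -> V v -> W (u * v^-1).
Proof. by case: tg => _ [_ [_ [_ [_ [_ h]]]]]; apply: h. Qed.

Lemma topen_local W :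
  (forall x, W x -> exists U, topen U /\ U x /\ forall z, U z -> W z) -> topen W.
Proof.
move=> h; apply: (@topen_ext (fun x => exists U,
   (topen U /\ forall z, U z -> W z) /\ U x)); last first.
  by apply: topen_bigU => U [].
move=> x; split=> [[U [[_ UW] Ux]]|/h [U [oU [Ux UW]]]]; first exact: UW.
by exists U.
Qed.

Lemma topenMr W y : topen W -> topen (fun x => W (x * y)).
Proof.
move=> oW; apply: topen_local => x Wxy.
have [|U [V [oU [oV [Ux [Vy h]]]]]] := @topen_div W x (y^-1) oW.
  by rewrite !tgE.
by exists U; split=> //; split=> // z Uz; have := h _ _ Uz Vy; rewrite !tgE.
Qed.

Lemma topenV W : topen W -> topen (fun x => W (x^-1)).
Proof.
move=> oW; apply: topen_local => x Wx.
have [|U [V [oU [oV [Ux [Vy h]]]]]] := @topen_div W 1 x oW.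
  by rewrite !tgE.
by exists V; split=> //; split=> // z Uz; have := h _ _ Ux Uz; rewrite !tgE.
Qed.

Lemma topenMl W y : topen W -> topen (fun x => W (y * x)).
Proof.
move=> /topenV/(@topenMr _ (y^-1))/topenV; apply: topen_ext => x.
by rewrite !tgE.
Qed.

Lemma tclosed_ext A U : (forall x, A x <-> U x) -> tclosed A -> tclosed U.
Proof. by move=> UW; suff -> : A = U by []; apply/predeqP. Qed.

Lemma tclosedI A U : tclosed A -> tclosed U -> tclosed (fun x => A x /\ U x).
Proof.
move=> cA cU; apply: topen_local => x /not_andP [nx|nx].
  by exists (fun x => ~ A x); split=> //; split=> // z Az [].
by exists (fun x => ~ U x); split=> //; split=> // z Az [].
Qed.

Lemma tclosed_bigI (I : Type) (C : I -> G -> Prop) :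
  (forall i, tclosed (C i)) -> tclosed (fun x => forall i, C i x).
Proof.
move=> cC; apply: topen_local => x /existsNP [i ni].
by exists (fun x => ~ C i x); split; [exact: cC | split=> // z Cz /(_ i)].
Qed.

Lemma topen_sub_closed U : subgrp U -> topen U -> tclosed U.
Proof.
move=> sU oU; apply: topen_local => x nUx.
exists (fun z => U (x^-1 * z)); split; first exact: topenMl.
split; first by rewrite !tgE; apply: sub1.
move=> z Uz Uz'; apply: nUx.
by apply: (subVr tg sU); have := subM sU Uz (subV sU Uz'); rewrite !tgE.
Qed.

Lemma tclosedMl A y : tclosed A -> tclosed (fun x => A (y * x)).
Proof. exact: topenMl. Qed.

Hypothesis cpt : tcompact G.

(** Otherwise the complements of the [C n] cover [G]; a finite subcover has a largest index [N], and
    [C N] would be empty. Limits are obtained below through this form of compactness. *)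
Lemma decreasing_closed_meet (C : nat -> G -> Prop) :
  (forall n, tclosed (C n)) -> (forall n x, C n.+1 x -> C n x) ->
  (forall n, exists x, C n x) -> exists x, forall n, C n x.
Proof.
move=> cC dC neC; apply: contrapT => /forallNP none.
have [||l [lF lc]] := @cpt (fun U => exists n, U = fun x => ~ C n x).
- by move=> _ [n ->]; apply: cC.
- move=> x; have /existsNP [n nC] := none x.
  by exists (fun x => ~ C n x); split=> //; exists n.
have dm m n x : C (m + n)%N x -> C n x.
  by elim: m => //= m IH; rewrite addSn => /dC.
have [N lN] : exists N, forall U, In U l -> forall x, C N x -> ~ U x.
  elim: l lF {lc} => [|U l IH] lF; first by exists 0.
  have [V lV|N lN] := IH; first by apply: lF; right.
  have [n Un] := lF U (or_introl erefl).
  exists (n + N)%N => W [<-|lW] x Cx.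
    by rewrite Un; apply; apply: (dm N); rewrite addnC.
  by apply: (lN _ lW); apply: (dm n).
have [x Cx] := neC N; have [U [lU Ux]] := lc x.
exact: lN lU _ Cx Ux.
Qed.

Lemma open_subgroup_reps U : subgrp U -> topen U ->
  exists l : list G, forall x, exists2 g, In g l & U (g^-1 * x).
Proof.
move=> sU oU.
have [||l [lF lc]] := @cpt (fun W => exists g, W = fun x => U (g^-1 * x)).
- by move=> _ [g ->]; apply: topenMl.
- move=> x; exists (fun z => U (x^-1 * z)); split; first by exists x.
  by rewrite !tgE; apply: sub1.
suff [m mP] : exists m : list G, forall W x, In W l -> W x ->
    exists2 g, In g m & U (g^-1 * x).
  by exists m => x; have [W [lW Wx]] := lc x; apply: mP lW Wx.
elim: l lF {lc} => [|W' l IH] lF; first by exists [::].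
have [V lV|m mP] := IH; first by apply: lF; right.
have [g Wg] := lF W' (or_introl erefl).
exists (g :: m) => V x [<-|lV] Vx.
  by exists g; [left | rewrite Wg in Vx].
by have [h mh Uh] := mP _ _ lV Vx; exists h; [right|].
Qed.

(** The conjugate of [U] by [g] depends only on the coset of [g], so by compactness the intersection
    of all conjugates is a finite one. *)
Lemma normal_core U : subgrp U -> topen U ->
  subgrp (fun x => forall g, U (g^-1 * x * g)) /\
  topen (fun x => forall g, U (g^-1 * x * g)).
Proof.
move=> sU oU; split.
  split; first by move=> g; rewrite !tgE; apply: sub1.
  split=> [x y Ux Uy g|x Ux g].
    by have := subM sU (Ux g) (Uy g); rewrite !tgE.
  by have := subV sU (Ux g); rewrite !tgE.
have [l lP] := open_subgroup_reps sU oU.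
have : topen (fun x => forall g, In g l -> U (g^-1 * x * g)).
  elim: l {lP} => [|g l IH].
    by apply: topen_ext topenT => x; split=> // _ g [].
  have := topenI (topenMl (g^-1) (topenMr g oU)) IH.
  apply: topen_ext => x; split=> [[Ug Ul] h [<-|lh]|Ul].
  - exact: Ug.
  - exact: Ul.
  - split; first by apply: Ul; left.
    by move=> h lh; apply: Ul; right.
apply: topen_ext => x; split=> Ux g; last by [].
have [h lh Uh] := lP g.
have := subM sU (subM sU (subV sU Uh) (Ux h lh)) Uh.
by rewrite !tgE.
Qed.

End Topology.

(** * Contraction and the basis of neighbourhoods *)

(** Call the coset of [V] containing the image of [x] under the power [t] of [a] the symbol of [x]
    at time [t]. Then [stays a V] is triviality of all symbols at times [t >= 0], and [stays b V],
    for [b] the inverse of [a], at times [t <= 0]. *)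
Definition stays (G : tgroup) (f : G -> G) (V : G -> Prop) (x : G) : Prop :=
  forall n, V (iter n f x).

(** The inverse [b] is carried along with [a] so that [expansive_sym] reverses time and each
    one-sided lemma can be used in both directions. *)
Record expansive (G : tgroup) (a b : G -> G) (V : G -> Prop) : Prop := {
  ex_tg : is_topgroup G;
  ex_cpt : tcompact G;
  ex_homa : hom a;
  ex_homb : hom b;
  ex_ab : cancel a b;
  ex_ba : cancel b a;
  ex_conta : tcontinuous a;
  ex_contb : tcontinuous b;
  ex_sub : subgrp V;
  ex_open : topen V;
  ex_norm : forall x g, V x -> V (tmul (tmul (tinv g) x) g);
  ex_sep : forall x, stays a V x -> stays b V x -> x = tone G }.

Lemma expansive_sym (G : tgroup) (a b : G -> G) V :
  expansive a b V -> expansive b a V.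
Proof. by case=> *; split; auto. Qed.

(** As [V] is normal and open these are open normal subgroups; [ball a b V n (x^-1 * y)] says that
    [x] and [y] have the same symbols at times -n to n. *)
Definition ball (G : tgroup) (a b : G -> G) (V : G -> Prop) n (x : G) : Prop :=
  forall k, k <= n -> V (iter k a x) /\ V (iter k b x).

Lemma ball_sym (G : tgroup) (a b : G -> G) V n x :
  ball a b V n x -> ball b a V n x.
Proof. by move=> h k /h []. Qed.

(** Stability is expressed by invariance under both [a] and its inverse, which is symmetric under
    time reversal. *)
Record stable_closed (G : tgroup) (a b : G -> G) (K : G -> Prop) : Prop := {
  sc_sub : subgrp K;
  sc_closed : tclosed K;
  sc_a : forall x, K x -> K (a x);
  sc_b : forall x, K x -> K (b x) }.

Lemma stable_closed_sym (G : tgroup) (a b : G -> G) K :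
  stable_closed a b K -> stable_closed b a K.
Proof. by case=> *; split; auto. Qed.

Lemma iter_cancel (T : Type) (f g : T -> T) n :
  cancel f g -> cancel (iter n f) (iter n g).
Proof. by move=> fK; elim: n => // n IH x; rewrite iterSr /= fK IH. Qed.

Lemma iter_cancel_le (T : Type) (f g : T -> T) m n x :
  cancel g f -> n <= m -> iter m f (iter n g x) = iter (m - n) f x.
Proof. by move=> gK nm; rewrite -{1}(subnK nm) iterD iter_cancel. Qed.

Lemma iter_cancel_ge (T : Type) (f g : T -> T) m n x :
  cancel g f -> m <= n -> iter m f (iter n g x) = iter (n - m) g x.
Proof. by move=> gK mn; rewrite -{1}(subnKC mn) iterD iter_cancel. Qed.

Lemma iter_cont (G : tgroup) (f : G -> G) n :
  tcontinuous f -> tcontinuous (iter n f).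
Proof.
by move=> cf; elim: n => // n IH U oU; apply: (IH (fun x => U (f x))); apply: cf.
Qed.

Lemma iter_closed (T : Type) (f : T -> T) (K : T -> Prop) n x :
  (forall x, K x -> K (f x)) -> K x -> K (iter n f x).
Proof. by move=> Kf Kx; elim: n => //= n; apply: Kf. Qed.

Section Balls.
Variables (G : tgroup) (a b : G -> G) (V : G -> Prop).
Hypothesis E : expansive a b V.
Local Notation "x * y" := (@tmul G x y).
Local Notation "x ^-1" := (@tinv G x).
Local Notation "1" := (tone G).
Local Notation Pa := (stays a V).
Local Notation ball := (ball a b V).
Let tg := ex_tg E.
Let sV := ex_sub E.

Lemma stays_sub : subgrp Pa.
Proof.
have h n := iter_hom (ex_homa E) n.
split; first by move=> n; rewrite (hom1 tg (h n)); apply: sub1.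
split=> [x y Px Py n|x Px n]; first by rewrite h; apply: subM.
by rewrite (homV tg (h n)); apply: subV.
Qed.

Lemma stays_norm x g : Pa x -> Pa (g^-1 * x * g).
Proof.
have h n := iter_hom (ex_homa E) n.
by move=> Px n; rewrite !h (homV tg (h n)); apply: (ex_norm E).
Qed.

Lemma stays_iter n x : Pa x -> Pa (iter n a x).
Proof. by move=> Px k; rewrite -iterD. Qed.

Lemma stays_ball n x : Pa x -> ball n (iter n a x).
Proof.
move=> Px k kn; split; first exact: stays_iter.
by rewrite (iter_cancel_ge _ (ex_ab E)).
Qed.

Lemma stays_iter_ball p n x : Pa x -> n <= p -> ball n (iter p a x).
Proof.
by move=> Px np; rewrite -(subnKC np) iterD; apply: stays_ball; apply: stays_iter.
Qed.

Lemma topen_iterV k : topen (fun x => V (iter k a x)).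
Proof. exact: (iter_cont k (ex_conta E) (ex_open E)). Qed.

Lemma tclosed_iterV k : tclosed (fun x => V (iter k a x)).
Proof.
exact: (iter_cont k (ex_conta E) (topen_sub_closed tg sV (ex_open E))).
Qed.

End Balls.

Section BallsBase.
Variables (G : tgroup) (a b : G -> G) (V : G -> Prop).
Hypothesis E : expansive a b V.
Local Notation "x * y" := (@tmul G x y).
Local Notation "x ^-1" := (@tinv G x).
Local Notation "1" := (tone G).
Local Notation ball := (ball a b V).
Let tg := ex_tg E.
Let tgE := tgE tg.
Let sV := ex_sub E.
Let E' := expansive_sym E.

Lemma ball_sub n : subgrp (ball n).
Proof.
have ha k := iter_hom (ex_homa E) k.
have hb k := iter_hom (ex_homb E) k.
split.
  by move=> k _; rewrite (hom1 tg (ha k)) (hom1 tg (hb k)); split; apply: sub1.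
split=> [x y Bx By k kn|x Bx k kn].
  have [? ?] := Bx k kn; have [? ?] := By k kn.
  by rewrite ha hb; split; apply: subM.
have [? ?] := Bx k kn.
by rewrite (homV tg (ha k)) (homV tg (hb k)); split; apply: subV.
Qed.

Lemma ball_norm n x g : ball n x -> ball n (g^-1 * x * g).
Proof.
have ha k := iter_hom (ex_homa E) k.
have hb k := iter_hom (ex_homb E) k.
move=> Bx k kn; have [? ?] := Bx k kn.
by rewrite !ha !hb (homV tg (ha k)) (homV tg (hb k)); split; apply: (ex_norm E).
Qed.

Lemma ball_le m n x : m <= n -> ball n x -> ball m x.
Proof. by move=> mn Bx k km; apply: Bx; apply: leq_trans km mn. Qed.

Lemma ball_V n x : ball n x -> V x.
Proof. by move=> /(_ 0 (leq0n n)) []. Qed.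

Lemma ball_open n : topen (ball n).
Proof.
elim: n => [|n IH].
  apply: topen_ext (ex_open E) => x; split=> [Vx k|/ball_V //].
  by rewrite leqn0 => /eqP ->.
have oS := topenI tg (topen_iterV E n.+1) (topen_iterV E' n.+1).
apply: topen_ext (topenI tg IH oS).
move=> x; split=> [[Bx Vx] k|Bx].
  by rewrite leq_eqVlt => /predU1P [->|]; [|apply: Bx].
by split; [apply: ball_le Bx | apply: Bx].
Qed.

Lemma ball_closed n : tclosed (ball n).
Proof. exact: topen_sub_closed (ball_sub n) (ball_open n). Qed.

Lemma ball_sep x : (forall n, ball n x) -> x = 1.
Proof.
move=> Bx; apply: (ex_sep E) => n; by have [] := Bx n n (leqnn n).
Qed.

(** Shifting by [m] turns the window from -n to n into one from m - n to m + n, which lies inside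
    the window of size m + n. *)
Lemma ball_iter_a m n x : ball (m + n) x -> ball n (iter m a x).
Proof.
move=> Bx k kn; split.
  by rewrite -iterD; apply: (Bx _ _).1; rewrite addnC leq_add2l.
case: (leqP m k) => mk.
  rewrite (iter_cancel_le _ (ex_ab E) mk); apply: (Bx _ _).2.
  by rewrite leq_subLR (leq_trans kn) // addnA leq_addl.
rewrite (iter_cancel_ge _ (ex_ab E) (ltnW mk)); apply: (Bx _ _).1.
by rewrite leq_subLR (leq_trans _ (leq_addl _ _)) // leq_addr.
Qed.

(** If every ball met the complement of [W], compactness would give a point outside [W] lying in all
    balls; by separation that point is 1. *)
Lemma ball_base W : topen W -> W 1 -> exists n, forall x, ball n x -> W x.
Proof.
move=> oW W1; apply: contrapT => /forallNP nW.
have [|n x [Bx nWx]|n|x hx] := decreasing_closed_meet (ex_cpt E)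
  (C := fun n x => ball n x /\ ~ W x).
- move=> n; apply: (tclosedI tg (ball_closed n)).
  by apply: topen_ext oW => x; split=> [? []|/contrapT].
- by split=> //; apply: ball_le Bx.
- apply: contrapT => h; apply: (nW n) => x Bx.
  by apply: contrapT => nWx; apply: h; exists x.
- have x1 : x = 1 by apply: ball_sep => n; case: (hx n).
  by case: (hx 0) => _; rewrite x1.
Qed.

Lemma ball_nbhd W x : topen W -> W x ->
  exists n, forall y, ball n (x^-1 * y) -> W y.
Proof.
move=> oW Wx; have [|n nW] := ball_base (topenMl tg x oW); first by rewrite tgE.
by exists n => y /nW; rewrite !tgE.
Qed.

Lemma topen_ballP W :
  (forall x, W x -> exists n, forall y, ball n (x^-1 * y) -> W y) -> topen W.
Proof.
move=> h; apply: topen_local => // x /h [n nW].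
exists (fun y => ball n (x^-1 * y)); split; first exact/topenMl/ball_open.
by split=> //; rewrite tgE; apply: sub1 (ball_sub n).
Qed.

Lemma closed_ball A x : tclosed A ->
  (forall n, exists2 y, A y & ball n (x^-1 * y)) -> A x.
Proof.
move=> cA hx; apply: contrapT => nAx.
by have [n nA] := ball_nbhd cA nAx; have [y Ay /nA] := hx n.
Qed.

Lemma tclosed_ballP A :
  (forall x, (forall n, exists2 y, A y & ball n (x^-1 * y)) -> A x) -> tclosed A.
Proof.
move=> h; apply: topen_ballP => x nAx; apply: contrapT => /forallNP nA.
apply/nAx/h => n; apply: contrapT => h'; apply: (nA n) => y By Ay.
by apply: h'; exists y.
Qed.

Lemma tclosed_cosets A n :
  (forall x y, A x -> ball n (x^-1 * y) -> A y) -> tclosed A.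
Proof.
move=> h; apply: tclosed_ballP => x /(_ n) [y /h + /(sub_divC tg (ball_sub n))].
exact.
Qed.

End BallsBase.

(** * Symbols followed by a trivial future, and openness of subgroups *)

Section ContractionSplitting.
Variables (G : tgroup) (a b : G -> G) (V : G -> Prop).
Hypothesis E : expansive a b V.
Local Notation "x * y" := (@tmul G x y).
Local Notation "x ^-1" := (@tinv G x).
Local Notation "1" := (tone G).
Local Notation Pa := (stays a V).
Let tg := ex_tg E.
Let tgE := tgE tg.
Let sV := ex_sub E.
Let E' := expansive_sym E.
Let ha k := iter_hom (ex_homa E) k.
Let haV k := homV tg (@ha k).

Lemma staysS x : V x -> Pa (a x) -> Pa x.
Proof. by move=> Vx Px [|n] //; rewrite iterSr. Qed.

(* [follow H g]: in symbolic terms, the coset gV can be the time-0 symbol of a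
   point of H all of whose later symbols are trivial. *)
Definition follow (H : G -> Prop) (g : G) : Prop :=
  exists h, [/\ H h, Pa (a h) & V (h^-1 * g)].

(** Elements of [H] correct the symbols of [x] one at a time, at times 0, -1, -2 and so on, each
    correction leaving all later symbols trivial. Hence [H] contains points agreeing with [x] from
    time -n on, and [H] is closed. *)
Lemma follow_le_stays H K : stable_closed a b H -> stable_closed a b K ->
  (forall x, H x -> K x) -> (forall x, follow K x -> follow H x) ->
  forall x, K x -> Pa x -> H x.
Proof.
move=> sH sK HK KH.
(* After [n] corrections [h^-1 * x] has trivial symbols at all times [>= 1 - n]; the shift
   [iter n b] brings the next symbol to be corrected to time 0. *)
have step n x : K x -> Pa (a x) ->
    exists2 h, H h & Pa (a (iter n b (h^-1 * x))).
  move=> Kx Px; elim: n => [|n [h Hh IH]].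
    by exists 1; rewrite ?tgE //; apply: sub1 (sc_sub sH).
  set w := iter n b _ in IH.
  have Kw : K w.
    by apply: (iter_closed _ (sc_b sK)); apply: (sub_div (sc_sub sK)) => //; apply: HK.
  have [|h' [Hh' Ph' Vh']] := KH w.
    by exists w; split=> //; rewrite tgE; apply: sub1 sV.
  exists (h * iter n a h').
    by apply: (subM (sc_sub sH)) => //; apply: (iter_closed _ (sc_a sH)).
  have -> : (h * iter n a h')^-1 * x = iter n a (h'^-1 * w).
    by rewrite ha haV (iter_cancel _ (ex_ba E)) !tgE.
  rewrite iterS (iter_cancel _ (ex_ab E)) (ex_ba E); apply: staysS => //.
  by rewrite (ex_homa E) (homV tg (ex_homa E)); apply: (sub_div (stays_sub E)).
move=> x Kx Px; apply: (closed_ball E (sc_closed sH)) => n.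
have [|h Hh Ph] := step n.+1 x Kx; first exact: (stays_iter 1 Px).
exists h => //; apply: (sub_divC tg (ball_sub E n)).
rewrite iterS (ex_ba E) in Ph.
by have := stays_ball E (n := n) Ph; rewrite (iter_cancel _ (ex_ba E)).
Qed.

End ContractionSplitting.

Section Splitting.
Variables (G : tgroup) (a b : G -> G) (V : G -> Prop).
Hypothesis E : expansive a b V.
Local Notation "x * y" := (@tmul G x y).
Local Notation "x ^-1" := (@tinv G x).
Local Notation "1" := (tone G).
Local Notation Pa := (stays a V).
Local Notation Pb := (stays b V).
Local Notation ball := (ball a b V).
Local Notation follow := (follow a V).
Let tg := ex_tg E.
Let tgE := tgE tg.
Let sV := ex_sub E.
Let E' := expansive_sym E.
Let ha k := iter_hom (ex_homa E) k.
Let hb k := iter_hom (ex_homb E) k.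
Let haV k := homV tg (@ha k).
Let hbV k := homV tg (@hb k).

Lemma follow_window K : stable_closed a b K ->
  exists N, forall x, K x -> (forall k, k < N -> V (iter k.+1 a x)) -> follow K x.
Proof.
move=> sK; apply: contrapT => /forallNP noN.
have [n|n x [Kx [Vx nf]]|n|x hx] := decreasing_closed_meet (ex_cpt E)
  (C := fun n x => K x /\ (forall k, k < n -> V (iter k.+1 a x)) /\ ~ follow K x).
- apply: (tclosedI tg (sc_closed sK)); apply: (tclosedI tg).
    apply: (tclosed_bigI tg) => k; apply: (tclosed_bigI tg) => _.
    exact: (tclosed_iterV E).
  (* [follow] depends only on the coset of [V], and [ball 0] is [V]. *)
  apply: (tclosed_cosets E (n := 0)) => x y nf Bxy [h [Kh Ph Vh]]; apply: nf.
  exists h; split=> //; apply: (sub_div_trans tg sV Vh).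
  exact: (sub_divC tg sV (ball_V Bxy)).
- by split=> //; split=> // k kn; apply: Vx; apply: ltnW.
- apply: contrapT => h; apply: (noN n) => x Kx Vx.
  by apply: contrapT => nf; apply: h; exists x.
- have [Kx [_]] := hx 0; apply; exists x; split=> //.
    by move=> k; rewrite -iterSr; have [_ [Vx _]] := hx k.+1; apply: Vx.
  by rewrite tgE; apply: sub1 sV.
Qed.

(** The window gives a follow symbol at each time 0, -1, -2 and so on, and the point of [K]
    realising it lies in [L]. Dividing by these points makes the past trivial step by step without
    spoiling times 1 to [N]; compactness gives a single [l], and [l^-1 * x] has trivial symbols at
    all times [<= N]. *)
Lemma split_window L K : stable_closed a b L -> stable_closed a b K ->
  (forall x, L x -> K x) -> (forall x, K x -> Pa x -> L x) ->
  exists N, forall x, K x -> (forall k, k < N -> V (iter k.+1 a x)) ->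
    exists2 l, L l & Pb (iter N a (l^-1 * x)).
Proof.
move=> sL sK LK PL; have [N KN] := follow_window sK; exists N => x Kx Vx.
pose inv n y := (forall k, k < N -> V (iter k.+1 a y)) /\
  (forall k, k < n -> V (iter k b y)).
have cV W : tclosed W -> tclosed (fun l => W (l^-1 * x)).
  by move=> cW; apply: (topenV tg (topenMr tg x cW)).
have [n|n l [Ll [Va Vb]]|n|l hl] := decreasing_closed_meet (ex_cpt E)
  (C := fun n l => L l /\ inv n (l^-1 * x)).
- apply: (tclosedI tg (sc_closed sL)); apply: (cV (inv n)).
  apply: (tclosedI tg); apply: (tclosed_bigI tg) => k;
    apply: (tclosed_bigI tg) => _; first exact: (tclosed_iterV E k.+1).
  exact: (tclosed_iterV E').
- by split=> //; split=> // k kn; apply: Vb; apply: ltnW.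
- elim: n => [|n [l [Ll [Va Vb]]]].
    exists 1; split; first exact: sub1 (sc_sub sL).
    by split=> // k; rewrite !tgE; apply: Vx.
  set y := l^-1 * x in Va Vb; pose w := iter n b y.
  have Ky : K y by apply: (sub_div (sc_sub sK)) => //; apply: LK.
  have [||z [Kz Pz Vz]] := KN w; first exact: (iter_closed n (sc_b sK) Ky).
    move=> k kN; rewrite /w; case: (leqP k.+1 n) => kn.
      rewrite (iter_cancel_ge _ (ex_ba E) kn); apply: Vb.
      by rewrite ltn_subrL (leq_trans _ kn).
    rewrite (iter_cancel_le _ (ex_ba E) (ltnW kn)) subSn //; apply: Va.
    exact: leq_ltn_trans (leq_subr _ _) kN.
  (* Only [a z] has trivial symbols from time 0 on, so [PL] is applied to it and [L] is pulled back
     by [b]. *)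
  have Lz : L z by rewrite -(ex_ab E z); apply/(sc_b sL)/PL => //; apply: (sc_a sK).
  have yE : (l * iter n a z)^-1 * x = (iter n a z)^-1 * y by rewrite !tgE.
  have zV k : V (iter k.+1 a z) by rewrite iterSr; apply: Pz.
  exists (l * iter n a z); split.
    by apply: (subM (sc_sub sL)) => //; apply: (iter_closed _ (sc_a sL)).
  rewrite yE; split=> k kN.
    rewrite ha haV -iterD addSn.
    by apply: (sub_div sV) => //; apply: Va.
  rewrite hb hbV; move: kN; rewrite ltnS leq_eqVlt => /predU1P [->|kn].
    by rewrite (iter_cancel _ (ex_ab E)).
  rewrite (iter_cancel_ge _ (ex_ab E) (ltnW kn)) -(subnSK kn).
  by apply: (sub_div sV) => //; apply: Vb.
- have [Ll [Va _]] := hl 0; exists l => // k.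
  case: (leqP N k) => kN.
    have [_ [_ Vb]] := hl (k - N).+1.
    by rewrite (iter_cancel_le _ (ex_ab E) kN); apply: Vb.
  rewrite (iter_cancel_ge _ (ex_ab E) (ltnW kN)) -(subnSK kN); apply: Va.
  by rewrite -subSn // subSS leq_subr.
Qed.

(** After splitting off [l], the shift by [N] of the remaining factor has trivial past, so it is in
    [L] by the second inclusion. *)
Lemma open_of_stays L K : stable_closed a b L -> stable_closed a b K ->
  (forall x, L x -> K x) -> (forall x, K x -> Pa x -> L x) ->
  (forall x, K x -> Pb x -> L x) ->
  exists N, forall x, K x -> ball N x -> L x.
Proof.
move=> sL sK LK PaL PbL; have [N KN] := split_window sL sK LK PaL.
exists N => x Kx Bx; have [|l Ll Pl] := KN x Kx.
  by move=> k kN; have [] := Bx _ kN.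
apply: (subMl tg (sc_sub sL) Ll).
rewrite -(iter_cancel N (ex_ab E) (l^-1 * x)); apply: (iter_closed _ (sc_b sL)).
apply: PbL => //; apply: (iter_closed _ (sc_a sK)).
by apply: (sub_div (sc_sub sK)) => //; apply: LK.
Qed.

Lemma orbit_in L x z : stable_closed a b L -> orbit a x z -> L x <-> L z.
Proof.
move=> sL [n [<-|<-]]; split; try exact: (iter_closed _ (sc_a sL)).
  by move=> /(iter_closed n (sc_b sL)); rewrite (iter_cancel _ (ex_ab E)).
by move=> /(iter_closed n (sc_b sL)); rewrite (iter_cancel _ (ex_ab E)).
Qed.

(** A dense orbit of [K] enters [L] near 1, hence lies in the stable [L] entirely; as the orbit
    comes close to every point of [K], openness of [L] in [K] absorbs all of [K]. *)
Lemma transitive_le_open K L N : topo_transitive_sub a K -> subgrp K ->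
  stable_closed a b L -> (forall x, K x -> ball N x -> L x) ->
  forall x, K x -> L x.
Proof.
move=> [x0 [Kx0 tr]] sK sL KL y Ky.
have [|z1 [o1 [Kz1 Bz1]]] := tr _ (ball_open E N).
  by exists 1; split; [apply: sub1 | apply: sub1 (ball_sub E N)].
have Lx0 : L x0 by apply/(orbit_in sL o1)/KL.
have [|z [o [Kz Bz]]] := tr _ (topenMl tg (y^-1) (ball_open E N)).
  by exists y; split=> //; rewrite tgE; apply: sub1 (ball_sub E N).
have Lz : L z by apply/(orbit_in sL o).
apply: (subMl tg (sc_sub sL) Lz); apply: KL; first exact: sub_div.
exact: (sub_divC tg (ball_sub E N)).
Qed.

End Splitting.

(** * Bounding strict chains by counting symbols *)

Section Depth.
Variables (G : tgroup) (a b : G -> G) (V : G -> Prop).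
Hypothesis E : expansive a b V.

(** [l] is meant to represent all cosets of [V]. Both time directions are counted because
    [open_of_stays] asks for both inclusions. *)
Definition depth (l : list G) (K : G -> Prop) : nat :=
  count (fun g => `[< follow a V K g >]) l +
  count (fun g => `[< follow b V K g >]) l.

Lemma follow_le (f : G -> G) (H K : G -> Prop) g :
  (forall x, H x -> K x) -> follow f V H g -> follow f V K g.
Proof. by move=> HK [h [/HK Kh Ph Vh]]; exists h. Qed.

Lemma count_le_eq (T : Type) (p q : pred T) (l : list T) :
  (forall x, p x -> q x) -> count q l <= count p l ->
  forall x, In x l -> q x -> p x.
Proof.
move=> pq; elim: l => //= y l IH.
have pql : count p l <= count q l by apply: sub_count.
case py: (p y); first by rewrite (pq _ py) leq_add2l => /IH h x [<-|/h].
case qy: (q y); first by rewrite add0n add1n => /leq_trans/(_ pql); rewrite ltnn.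
by rewrite !add0n => /IH h x [<-|/h] //; rewrite qy.
Qed.

Lemma follow_coset (f : G -> G) (K : G -> Prop) x y :
  follow f V K x -> V (tmul (tinv x) y) -> follow f V K y.
Proof.
move=> [h [Kh Ph Vh]] Vxy; exists h; split=> //.
exact: (sub_div_trans (ex_tg E) (ex_sub E) Vh Vxy).
Qed.

(** If the depth did not grow, [H] and [K] would have the same follow symbols in both directions.
    Then [H] contains the one-sided trivial points of [K], is open in [K], and equals [K] by
    transitivity. *)
Lemma depth_lt l H K :
  (forall x, exists2 g, In g l & V (tmul (tinv g) x)) ->
  stable_closed a b H -> stable_closed a b K -> topo_transitive_sub a K ->
  (forall x, H x -> K x) -> (exists x, K x /\ ~ H x) -> depth l H < depth l K.
Proof.
move=> lP sH sK tK HK [x0 [Kx0 nHx0]]; rewrite ltnNge; apply/negP => le.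
have mono f : count (fun g => `[< follow f V H g >]) l <=
    count (fun g => `[< follow f V K g >]) l.
  by apply: sub_count => g /asboolP fg; apply/asboolP; apply: follow_le fg.
have back f : count (fun g => `[< follow f V K g >]) l <=
    count (fun g => `[< follow f V H g >]) l ->
    forall x, follow f V K x -> follow f V H x.
  move=> lef x fx; have [g lg Vg] := lP x.
  suff : follow f V H g by move=> /follow_coset; apply.
  apply/asboolP; apply: (count_le_eq _ lef lg).
    by move=> y /asboolP fy; apply/asboolP; apply: follow_le fy.
  apply/asboolP; apply: (follow_coset fx).
  exact: (sub_divC (ex_tg E) (ex_sub E)).
have la : count (fun g => `[< follow a V K g >]) l <=
    count (fun g => `[< follow a V H g >]) l.
  by rewrite -(leq_add2r (count (fun g => `[< follow b V K g >]) l));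
     apply: (leq_trans le); rewrite leq_add2l.
have lb : count (fun g => `[< follow b V K g >]) l <=
    count (fun g => `[< follow b V H g >]) l.
  by rewrite -(leq_add2l (count (fun g => `[< follow a V K g >]) l));
     apply: (leq_trans le); rewrite leq_add2r.
have [|||N HN] := open_of_stays E sH sK.
- exact: HK.
- by apply: (follow_le_stays E sH sK HK); apply: back.
- by apply: (follow_le_stays (expansive_sym E) (stable_closed_sym sH)
    (stable_closed_sym sK) HK); apply: back.
exact/nHx0/(transitive_le_open E tK (sc_sub sK) sH HN).
Qed.

Lemma depth_bound l K : depth l K <= size l + size l.
Proof. by apply: leq_add; apply: count_size. Qed.

End Depth.

(** * The core of a stable subgroup *)

(* The closure of the group of points of H contracted by [a]; it turns out to
   be the largest topologically transitive subgroup of H. *)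
Definition core (G : tgroup) (a b : G -> G) (V H : G -> Prop) (x : G) : Prop :=
  forall n, exists c,
    [/\ H c, exists m, stays a V (iter m a c) & ball a b V n (tmul (tinv x) c)].

Lemma nat_pigeonhole (T : Type) (l : list T) (P : nat -> T -> Prop) :
  (forall n, exists2 g, In g l & P n g) ->
  exists m n g, [/\ m < n, P m g & P n g].
Proof.
move=> hP.
have hk n : exists k : 'I_(size l), forall d, P n (seq.nth d l k).
  have [g lg Pg] := hP n; elim: l lg {hP} => //= h l IH [->|/IH [k hk]].
    by exists ord0.
  by exists (lift ord0 k) => d; rewrite lift0 /=.
have [f fP] := choice hk.
have /injectivePn [i [j ij fij]] : ~~ injectiveb (fun i : 'I_(size l).+1 => f i).
  apply/negP => /injectiveP/leq_card; rewrite !card_ord ltnn //.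
have [d _ _] := hP 0.
wlog lt_ij : i j ij fij / i < j => [th|].
  case: (ltngtP i j) => [|ji|/val_inj e]; [exact: th | | by rewrite e eqxx in ij].
  by apply: (th j i) => //; rewrite eq_sym.
exists i, j, (seq.nth d l (f i)); split=> //.
by rewrite fij; apply: fP.
Qed.

Section CoreBasics.
Variables (G : tgroup) (a b : G -> G) (V : G -> Prop).
Hypothesis E : expansive a b V.
Local Notation "x * y" := (@tmul G x y).
Local Notation "x ^-1" := (@tinv G x).
Local Notation "1" := (tone G).
Local Notation Pa := (stays a V).
Local Notation Pb := (stays b V).
Local Notation ball := (ball a b V).
Let tg := ex_tg E.
Let tgE := tgE tg.
Let E' := expansive_sym E.
Let ha k := iter_hom (ex_homa E) k.
Let hb k := iter_hom (ex_homb E) k.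
Let haV k := homV tg (@ha k).
Let hbV k := homV tg (@hb k).

(** Eventual triviality of the symbols is the same as convergence of [iter n a x] to 1, since the
    balls form a base at 1. *)
Definition contracted x := exists m, Pa (iter m a x).

Lemma contracted_sub : subgrp contracted.
Proof.
have s := stays_sub E; split; first by exists 0; apply: sub1 s.
split=> [x y [m Px] [n Py]|x [m Px]].
  exists (m + n)%N; rewrite ha; apply: (subM s).
    by rewrite addnC iterD; apply: stays_iter.
  by rewrite iterD; apply: stays_iter.
by exists m; rewrite haV; apply: (subV s).
Qed.

Lemma contracted_norm x g : contracted x -> contracted (g^-1 * x * g).
Proof.
by move=> [m Px]; exists m; rewrite !ha haV; apply: (stays_norm E).
Qed.

Lemma contracted_ball n x : contracted x ->
  exists m, forall p, m <= p -> ball n (iter p a x).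
Proof.
move=> [m Px]; exists (n + m)%N => p np.
have mp : m <= p by apply: leq_trans np; rewrite leq_addl.
rewrite -(subnK mp) iterD; apply: (stays_iter_ball E Px).
by rewrite leq_subRL // addnC.
Qed.

Variable H : G -> Prop.
Hypothesis sH : stable_closed a b H.
Local Notation D := (core a b V H).

Lemma core_le x : D x -> H x.
Proof.
move=> Dx; apply: (closed_ball E (sc_closed sH)) => n.
by have [c [Hc _ Bc]] := Dx n; exists c.
Qed.

Lemma contracted_core x : H x -> contracted x -> D x.
Proof.
by move=> Hx cx n; exists x; split=> //; rewrite tgE; apply: sub1 (ball_sub E n).
Qed.

Lemma stays_core x : H x -> Pa x -> D x.
Proof. by move=> Hx Px; apply: contracted_core => //; exists 0. Qed.

Lemma core_stable_closed : stable_closed a b D.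
Proof.
have sB n := ball_sub E n; split.
- split.
    by apply: contracted_core; [apply: sub1 (sc_sub sH) | apply: sub1 contracted_sub].
  split=> [x y Dx Dy n|x Dx n].
    have [c [Hc cc Bc]] := Dx n; have [d [Hd cd Bd]] := Dy n.
    exists (c * d); split; [exact: (subM (sc_sub sH)) | exact: (subM contracted_sub) |].
    by have := subM (sB n) (ball_norm E y Bc) Bd; rewrite !tgE.
  have [c [Hc cc Bc]] := Dx n.
  exists (c^-1); split; [exact: (subV (sc_sub sH)) | exact: (subV contracted_sub) |].
  by have := ball_norm E (c^-1) (subV (sB n) Bc); rewrite !tgE.
- apply: (tclosed_ballP E) => x hx n.
  have [y Dy Bxy] := hx n; have [c [Hc cc Bc]] := Dy n.
  by exists c; split=> //; apply: (sub_div_trans tg (sB n) Bxy Bc).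
- move=> x Dx n; have [c [Hc [m cc] Bc]] := Dx n.+1.
  exists (a c); split; first exact: (sc_a sH).
    by exists m; rewrite -iterSr; apply: (stays_iter 1).
  have := ball_iter_a E (m := 1) (n := n) Bc.
  by rewrite /= (ex_homa E) (homV tg (ex_homa E)).
- move=> x Dx n; have [c [Hc [m cc] Bc]] := Dx n.+1.
  exists (b c); split; first exact: (sc_b sH).
    by exists m.+1; rewrite iterSr (ex_ba E).
  have := ball_iter_a E' (m := 1) (n := n) (ball_sym Bc).
  by rewrite /= (ex_homb E) (homV tg (ex_homb E)) => B; apply: ball_sym.
Qed.

Lemma core_norm x g : (forall h, H h -> H (g^-1 * h * g)) ->
  D x -> D (g^-1 * x * g).
Proof.
move=> Hg Dx n; have [c [Hc cc Bc]] := Dx n.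
exists (g^-1 * c * g); split; [exact: Hg | exact: contracted_norm |].
by have := ball_norm E g Bc; rewrite !tgE.
Qed.

(* O is an open subgroup with b(O) <= O, hence a(O) = O by finiteness of its
   index; the elements of O are then split at arbitrarily late times. *)
Lemma core_open : exists N, forall x, H x -> ball N x -> D x.
Proof.
have sD := core_stable_closed; have s := stays_sub E'.
have [N HN] := split_window E sD sH core_le stays_core.
(* [O] is the product of [D] with the group of points whose symbols at all times [<= N] are
   trivial. *)
pose O x := exists2 l, D l & Pb (iter N a (l^-1 * x)).
have DO x g : H g -> D x -> D (g^-1 * x * g).
  move=> Hg; apply: core_norm => h Hh.
  by apply: (subM (sc_sub sH)) => //; apply: (sub_div (sc_sub sH)).
have OH x : H x -> ball N x -> O x.
  by move=> Hx Bx; apply: HN => // k kN; have [] := Bx _ kN.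
have Oiter n x : O x -> O (iter n b x).
  move=> [l Dl Pl]; exists (iter n b l); first exact: (iter_closed _ (sc_b sD)).
  rewrite -hbV -hb.
  suff -> : iter N a (iter n b (l^-1 * x)) = iter n b (iter N a (l^-1 * x)).
    exact: stays_iter.
  set z := l^-1 * x; rewrite -{1}(iter_cancel N (ex_ab E) z) -iterD addnC iterD.
  by rewrite (iter_cancel _ (ex_ba E)).
have OM x y : H x -> O x -> O y -> O (x * y).
  move=> Hx [l Dl Pl] [m Dm Pm].
  (* [x * y] is [l * (z * m * z^-1)] times [z * (m^-1 * y)]; normality of [D] in [H] keeps the first
     factor in [D]. *)
  pose z := l^-1 * x.
  exists (l * (z * m * z^-1)).
    apply: (subM (sc_sub sD)) => //; rewrite -{1}(tinvK tg z); apply: DO => //.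
    by apply: (subV (sc_sub sH)); apply: (sub_div (sc_sub sH)) => //; apply: core_le.
  have -> : (l * (z * m * z^-1))^-1 * (x * y) = z * (m^-1 * y).
    by rewrite !tgE -!tmulA // [l^-1 * (x * _)]tmulA // -/z !tgE.
  by rewrite ha; apply: (subM s).
have OV x : H x -> O x -> O (x^-1).
  move=> Hx [l Dl Pl]; exists (x^-1 * l^-1 * x).
    by apply: DO => //; apply: (subV (sc_sub sD)).
  have -> : (x^-1 * l^-1 * x)^-1 * x^-1 = x^-1 * l * 1 by rewrite !tgE.
  rewrite tmulx1 // -[x^-1 * l](tinvK tg) haV.
  by apply: (subV s); rewrite tinvM // tinvK.
have Oa x : H x -> O x -> O (a x).
  move=> Hx Ox.
  (* Two forward iterates of [a x], at times [m < n], lie in the same coset of [ball N], so their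
     quotient is in [O]. Applying [iter n b] to it gives the quotient of [a x] by a backward iterate
     of [x], and that iterate is already in [O]. *)
  have [l lP] := open_subgroup_reps tg (ex_cpt E) (ball_sub E N) (ball_open E N).
  have [m [n [g [mn Bm Bn]]]] :=
    nat_pigeonhole (P := fun n g => ball N (g^-1 * iter n a (a x))) (fun n => lP _).
  have Hi k : H (iter k a (a x)) by apply/(iter_closed _ (sc_a sH))/(sc_a sH).
  have {Bm Bn} : O ((iter m a (a x))^-1 * iter n a (a x)).
    apply: OH; first exact: (sub_div (sc_sub sH)).
    by apply: (sub_div_trans tg (ball_sub E N) _ Bn); apply: (sub_divC tg (ball_sub E N)).
  move=> /(Oiter n); rewrite hb hbV (iter_cancel _ (ex_ab E)).
  rewrite (iter_cancel_le _ (ex_ab E) (ltnW mn)) -(subnSK mn) iterSr (ex_ab E) => Oq.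
  have Hq : H (iter (n - m.+1) b x) by apply: (iter_closed _ (sc_b sH)).
  have := OM _ _ Hq (Oiter _ _ Ox) Oq.
  by rewrite !tgE.
exists N => x Hx /(OH x Hx) Ox.
have Oi n : O (iter n a x).
  elim: n => // n IH; apply: Oa IH; exact: (iter_closed _ (sc_a sH)).
apply: (closed_ball E (sc_closed sD)) => n.
have [l Dl Pl] := Oi n.
exists (iter n b l); first exact: (iter_closed _ (sc_b sD)).
apply: (sub_divC tg (ball_sub E n)); apply: ball_sym.
have -> : (iter n b l)^-1 * x = iter (n + N) b (iter N a (l^-1 * iter n a x)).
  by rewrite iterD (iter_cancel _ (ex_ab E)) hb hbV (iter_cancel _ (ex_ab E)).
exact: (stays_iter_ball E' Pl (leq_addr _ _)).
Qed.

End CoreBasics.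

Section CoreSym.
Variables (G : tgroup) (a b : G -> G) (V : G -> Prop).
Hypothesis E : expansive a b V.
Local Notation "x * y" := (@tmul G x y).
Local Notation "x ^-1" := (@tinv G x).
Local Notation "1" := (tone G).
Let E' := expansive_sym E.

Variable H : G -> Prop.
Hypothesis sH : stable_closed a b H.
Local Notation D := (core a b V H).
Let sD := core_stable_closed E sH.

(** The core for [b] is open in [H], so a point of [H] contracted by [a] eventually enters it, and
    stability brings the point itself back into it. *)
Lemma core_sym x : D x -> core b a V H x.
Proof.
have sH' := stable_closed_sym sH.
have sD' := stable_closed_sym (core_stable_closed E' sH').
have [N HN] := core_open E' sH'.
move=> Dx; apply: (closed_ball E (sc_closed sD')) => n.
have [c [Hc cc Bc]] := Dx n; exists c => //.
have [m /(_ m (leqnn m)) Bm] := contracted_ball E N cc.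
rewrite -(iter_cancel m (ex_ab E) c); apply: (iter_closed _ (sc_b sD')).
by apply: HN; [apply: (iter_closed _ (sc_a sH)) | apply: ball_sym].
Qed.

(** The core is open in [H], so a transitive subgroup of [H] cannot leave it. *)
Lemma core_max K : topo_transitive_sub a K -> subgrp K ->
  (forall x, K x -> H x) -> forall x, K x -> D x.
Proof.
have [N HN] := core_open E sH.
move=> tK sK KH; apply: (transitive_le_open E tK sK sD (N := N)) => x Kx.
by apply: HN; apply: KH.
Qed.

End CoreSym.

(** * Topological transitivity of the core *)

Section CoreTransitive.
Variables (G : tgroup) (a b : G -> G) (V : G -> Prop).
Hypothesis E : expansive a b V.
Local Notation "x * y" := (@tmul G x y).
Local Notation "x ^-1" := (@tinv G x).
Local Notation "1" := (tone G).
Local Notation ball := (ball a b V).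
Let tg := ex_tg E.
Let tgE := tgE tg.
Let E' := expansive_sym E.
Let ha k := iter_hom (ex_homa E) k.
Let haV k := homV tg (@ha k).
Let sB n := ball_sub E n.

Variable H : G -> Prop.
Hypothesis sH : stable_closed a b H.
Local Notation D := (core a b V H).
Let sD := core_stable_closed E sH.

(* Points of D are limits both of forward and of backward contracted points;
   the product of one of each kind is near x at time 0 and near y at time p. *)
Lemma core_mixing n m x y : D x -> D y ->
  exists p z, [/\ D z, ball n (x^-1 * z) & ball m (y^-1 * iter p a z)].
Proof.
have sH' := stable_closed_sym sH.
move=> Dx Dy; have [c [Hc cc Bc]] := Dx n.
have [d [Hd cd Bd]] := core_sym E sH Dy m.
have [p1 hp1] := contracted_ball E m cc.
have [p2 hp2] := contracted_ball E' n cd.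
have Dc : D c by apply: contracted_core.
have Dd : D d by apply: (core_sym E' sH'); apply: contracted_core.
exists (p1 + p2)%N, (c * iter (p1 + p2) b d); split.
- by apply: (subM (sc_sub sD)) => //; apply: (iter_closed _ (sc_b sD)).
- rewrite tmulA //; apply: (subM (sB n)) => //.
  by apply: ball_sym; apply: hp2; apply: leq_addl.
- rewrite ha (iter_cancel _ (ex_ba E)).
  have Bp := ball_norm E d (hp1 _ (leq_addr p2 p1)).
  by have := subM (sB m) (ball_sym Bd) Bp; rewrite !tgE.
Qed.

(** Mixing gives a point visiting a neighbourhood of [y] at time [p]; the window [n + (p + m)] is
    wide enough for every point agreeing with it there to make the same visit. *)
Lemma core_visit n m x y : D x -> D y ->
  exists z k p, [/\ D z, n <= k, ball n (x^-1 * z) &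
    forall w, ball k (z^-1 * w) -> ball m (y^-1 * iter p a w)].
Proof.
move=> Dx Dy; have [p [z [Dz Bz Bp]]] := core_mixing n m Dx Dy.
exists z, (n + (p + m))%N, p; split=> //; first exact: leq_addr.
move=> w Bw; have := ball_iter_a E (m := p) (n := m) (ball_le (leq_addl n _) Bw).
by rewrite ha haV; apply: (sub_div_trans tg (sB m)).
Qed.

Lemma core_visit_list (l : list G) n m x : D x ->
  exists z k, [/\ D z, n <= k, ball n (x^-1 * z) &
    forall w, ball k (z^-1 * w) -> forall y, In y l -> D y ->
      exists p, ball m (y^-1 * iter p a w)].
Proof.
elim: l n x => [|y l IH] n x Dx.
  by exists x, n; split=> //; rewrite tgE; apply: sub1 (sB n).
have [z [k [Dz nk Bz zl]]] := IH n x Dx.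
case: (pselect (D y)) => Dy; last first.
  exists z, k; split=> // w Bw y' [<-|ly'] //; exact: zl.
have [z' [k' [p [Dz' kk' Bz' z'y]]]] := core_visit k m Dz Dy.
exists z', k'; split=> //; first exact: leq_trans kk'.
  exact: (sub_div_trans tg (sB n) Bz (ball_le nk Bz')).
move=> w Bw y' [<-|ly'] Dy'; first by exists p; apply: z'y.
by apply: zl => //; apply: (sub_div_trans tg (sB k) Bz'); apply: ball_le Bw.
Qed.

Lemma core_visit_all n m x : D x ->
  exists z k, [/\ D z, n <= k, ball n (x^-1 * z) &
    forall w, ball k (z^-1 * w) -> forall y, D y ->
      exists p, ball m (y^-1 * iter p a w)].
Proof.
move=> Dx.
have [l lP] := open_subgroup_reps tg (ex_cpt E) (sB m) (ball_open E m).
(* [f] replaces each coset representative by a point of [D] in its coset, with 1 as a default if the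
   coset misses [D]. Finitely many targets thus account for all of [D]. *)
have /choice [f fP] : forall g, exists y, (exists2 y, D y & ball m (g^-1 * y)) ->
    D y /\ ball m (g^-1 * y).
  move=> g; case: (pselect (exists2 y, D y & ball m (g^-1 * y))) => [[y Dy By]|no].
    by exists y.
  by exists 1.
have [z [k [Dz nk Bz zl]]] := core_visit_list (map f l) n m Dx.
exists z, k; split=> // w Bw y Dy; have [g lg Bg] := lP y.
have [|Dfg Bfg] := fP g; first by exists y.
have [p Bp] := zl w Bw (f g) (in_map f l g lg) Dfg; exists p.
apply: (sub_div_trans tg (sB m) _ Bp).
by apply: (sub_div_trans tg (sB m) _ Bfg); apply: (sub_divC tg (sB m)).
Qed.

(** A Baire argument by hand: nested balls are chosen so that all points of the ball obtained at
    stage [m] visit every coset of [ball m] that meets [D]. The common point has a dense forward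
    orbit. *)
Lemma core_transitive : topo_transitive_sub a D.
Proof.
have /choice [f fP] : forall q : nat * (G * nat), exists r : G * nat, D q.2.1 ->
    [/\ D r.1, maxn q.1 q.2.2 <= r.2, ball q.2.2 (q.2.1^-1 * r.1) &
    forall w, ball r.2 (r.1^-1 * w) -> forall y, D y ->
      exists p, ball q.1 (y^-1 * iter p a w)].
  (* A pair [(x, n)] stands for the coset of [ball n] at [x]. Taking the window at least [maxn m n]
     makes the balls both nested and shrinking; [(1, 0)] is a default for centres outside [D]. *)
  case=> m [x n] /=; case: (pselect (D x)) => [Dx|]; last by exists (1, 0).
  have [z [k [Dz nk Bz zw]]] := core_visit_all (maxn m n) m Dx.
  by exists (z, k) => _; split=> //; apply: ball_le Bz; apply: leq_maxr.
pose s := fix s n := if n is m.+1 then f (m, s m) else (1, 0).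
have Ds n : D (s n).1.
  elim: n => [|n IH]; first exact: sub1 (sc_sub sD).
  by have [] := fP (n, s n) IH.
have sS n := fP (n, s n) (Ds n).
have [n|n x Bx|n|z hz] := decreasing_closed_meet (ex_cpt E)
  (C := fun n x => ball (s n).2 ((s n).1^-1 * x)).
- exact: (tclosedMl tg _ (ball_closed E _)).
- have [_ le Bs _] := sS n; apply: (sub_div_trans tg (sB _) Bs).
  by apply: ball_le Bx; apply: leq_trans le; apply: leq_maxr.
- by exists (s n).1; rewrite tgE; apply: sub1 (sB _).
have Dz : D z.
  apply: (closed_ball E (sc_closed sD)) => n; exists (s n.+1).1 => //.
  have [_ le _ _] := sS n; apply: (sub_divC tg (sB n)).
  by apply: ball_le (hz n.+1); apply: leq_trans le; apply: leq_maxl.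
exists z; split=> // U oU [y [Dy Uy]].
have [m mU] := ball_nbhd E oU Uy.
have [_ _ _ /(_ z (hz m.+1) y Dy) [p Bp]] := sS m.
exists (iter p a z); split; first by exists p; left.
by split; [apply: (iter_closed _ (sc_a sD)) | apply: mU].
Qed.

End CoreTransitive.

(** * Quotients *)

(** Finiteness of the image of [A] modulo [N], also for [A] not containing [N], as for an
    intersection of terms of two series. *)
Definition finite_over (G : tgroup) (A N : G -> Prop) : Prop :=
  exists l : list G, forall x, A x -> exists2 y, In y l & N (tmul (tinv y) x).

Section QuotientBasics.
Variable G : tgroup.
Hypothesis tg : is_topgroup G.
Local Notation "x * y" := (@tmul G x y).
Local Notation "x ^-1" := (@tinv G x).
Local Notation "1" := (tone G).
Let tgE := tgE tg.

Variables K N : G -> Prop.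
Hypotheses (hK : subgrp K) (sN : subgrp N) (nNK : normal_in N K).
Local Notation Q := (quot N hK).

(** Cosets are handled through their members, which frees the arguments from the chosen
    representative [qrep]. *)
Definition mem (q : Q) (x : G) : Prop := proj1_sig q x.

Lemma mem_coset (q : Q) x : mem q x -> proj1_sig q = coset N x.
Proof.
rewrite /mem; case: q => A /= [y [Ky ->]] Nyx; apply/predeqP => z; split=> Nz.
  exact: (sub_div_trans tg sN (sub_divC tg sN Nyx) Nz).
exact: (sub_div_trans tg sN Nyx Nz).
Qed.

Lemma coset_mem (q : Q) x : proj1_sig q = coset N x -> mem q x.
Proof. by rewrite /mem => ->; rewrite /coset tgE; apply: sub1. Qed.

Lemma mem_rep (q : Q) : mem q (qrep q).
Proof.
apply: coset_mem; rewrite /qrep.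
by case: (ClassicalEpsilon.constructive_indefinite_description _ _) => x [].
Qed.

Lemma mem_inj (q r : Q) x : mem q x -> mem r x -> q = r.
Proof.
move=> /mem_coset qx /mem_coset rx; move: q r qx rx => [A hA] [B hB] /= eA eB.
have AB : A = B by rewrite eA eB.
by case: _ / AB hB eB => hB _; congr exist; apply: Prop_irrelevance.
Qed.

Lemma mem_rel (q : Q) x y : mem q x -> mem q y -> N (x^-1 * y).
Proof. by move=> /mem_coset e; rewrite /mem e. Qed.

Lemma rel_mem (q : Q) x y : mem q x -> N (x^-1 * y) -> mem q y.
Proof. by move=> /mem_coset e; rewrite /mem e. Qed.

Lemma mem_K (q : Q) x : mem q x -> K x.
Proof.
rewrite /mem; case: q => A /= [y [Ky ->]] /(proj1 nNK).
exact: (subMl tg hK).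
Qed.

Lemma mem_qmk x (Kx : K x) : mem (qmk N Kx : Q) x.
Proof. exact: coset_mem. Qed.

Lemma mem_ex x : K x -> exists q : Q, mem q x.
Proof. by move=> Kx; exists (qmk N Kx); apply: mem_qmk. Qed.

Lemma mem_mul (q r : Q) x y : mem q x -> mem r y -> mem (tmul q r) (x * y).
Proof.
move=> qx ry; apply: (rel_mem (mem_qmk _)).
have Ky := mem_K ry; have Nq := mem_rel (mem_rep q) qx.
have Nr := mem_rel (mem_rep r) ry.
have := subM sN Nr (proj2 nNK _ _ Ky Nq).
by rewrite !tgE.
Qed.

Lemma mem_one x : mem (tone Q) x <-> N x.
Proof.
have := mem_qmk (sub1 hK); rewrite (_ : qmk N (sub1 hK) = tone Q); last first.
  by apply: (mem_inj (x := 1)); apply: mem_qmk.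
move=> q1; split=> [/(mem_rel q1)|Nx]; first by rewrite !tgE.
by apply: (rel_mem q1); rewrite !tgE.
Qed.

Lemma mem_inv (q : Q) x : mem q x -> mem (tinv q) (x^-1).
Proof.
move=> qx; apply: (rel_mem (mem_qmk _)).
have Kx := mem_K qx.
have := proj2 nNK _ _ (subV hK Kx) (sub_divC tg sN (mem_rel (mem_rep q) qx)).
by rewrite !tgE.
Qed.

Lemma quot_openE (S : Q -> Prop) : topen S <->
  exists U, topen U /\ forall y, K y -> ((exists q, S q /\ mem q y) <-> U y).
Proof.
split=> -[U [oU h]]; exists U; split=> // y Ky; rewrite -(h y Ky);
  split=> -[q [Sq qy]]; exists q; split=> //; by [exact: coset_mem | exact: mem_coset].
Qed.

Lemma quot_open_image (A : G -> Prop) : topen A ->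
  topen (fun q : Q => exists2 x, A x & mem q x).
Proof.
move=> oA; apply/quot_openE.
exists (fun y => exists U, (exists n, N n /\ U = fun y => A (y * n)) /\ U y); split.
  by apply: (topen_bigU tg) => _ [n [_ ->]]; apply: topenMr.
move=> y Ky; split=> [[q [[x Ax qx] qy]]|[_ [[n [Nn ->]] Ayn]]].
  exists (fun z => A (z * (y^-1 * x))); split; last by rewrite !tgE.
  by exists (y^-1 * x); split=> //; apply: mem_rel qy qx.
have [q qy] := mem_ex Ky; exists q; split=> //; exists (y * n) => //.
by apply: (rel_mem qy); rewrite !tgE.
Qed.

Lemma quot_topgroup : is_topgroup Q.
Proof.
split; [|split; [|split; [|split; [|split; [|split]]]]].
- move=> x y z; have mx := mem_rep x; have my := mem_rep y; have mz := mem_rep z.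
  apply: (mem_inj (mem_mul mx (mem_mul my mz))).
  by rewrite (tmulA tg); apply: mem_mul => //; apply: mem_mul.
- move=> x; apply: (mem_inj _ (mem_rep x)).
  have -> : qrep x = 1 * qrep x by rewrite tgE.
  by apply: (mem_mul _ (mem_rep x)); apply/mem_one; apply: sub1.
- move=> x; apply: (mem_inj (x := 1)); last by apply/mem_one; apply: sub1.
  by rewrite -(tmulV tg (qrep x)); apply: mem_mul (mem_rep x); apply/mem_inv/mem_rep.
- apply/quot_openE; exists (fun _ => True); split; first exact: topenT.
  by move=> y Ky; split=> // _; have [q] := mem_ex Ky; exists q.
- move=> U W /quot_openE [U' [oU hU]] /quot_openE [W' [oW hW]]; apply/quot_openE.
  exists (fun x => U' x /\ W' x); split; first exact: topenI.
  move=> y Ky; rewrite -(hU y Ky) -(hW y Ky); split.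
    by move=> [q [[Uq Wq] qy]]; split; exists q.
  by move=> [[q [Uq qy]] [r [Wr ry]]]; exists q; split=> //; rewrite {2}(mem_inj qy ry).
- move=> F hF; apply/quot_openE.
  exists (fun x => exists U, (topen U /\ exists S, F S /\ forall y, K y ->
     ((exists q, S q /\ mem q y) <-> U y)) /\ U x); split.
    by apply: (topen_bigU tg) => U [].
  move=> y Ky; split=> [[q [[S [FS Sq]] qy]]|[U [[oU [S [FS hS]]] Uy]]].
    have /quot_openE [U [oU hU]] := hF S FS.
    exists U; split; first by split=> //; exists S.
    by apply/(hU y Ky); exists q.
  have /(hS y Ky) [q [Sq qy]] := Uy.
  by exists q; split=> //; exists S.
- move=> W x y /quot_openE [U [oU hU]] Wxy.
  have mxy := mem_mul (mem_rep x) (mem_inv (mem_rep y)).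
  have [|A [B [oA [oB [Ax [By hAB]]]]]] := topen_div tg oU (x := qrep x) (y := qrep y).
    by apply/hU; [apply: mem_K mxy | exists (tmul x (tinv y))].
  exists (fun q => exists2 z, A z & mem q z), (fun q => exists2 z, B z & mem q z).
  split; first exact: quot_open_image.
  split; first exact: quot_open_image.
  split; first by exists (qrep x) => //; apply: mem_rep.
  split; first by exists (qrep y) => //; apply: mem_rep.
  move=> u v [z Az uz] [w Bw vw].
  have muv := mem_mul uz (mem_inv vw).
  have /hU := hAB _ _ Az Bw; case; first exact: mem_K muv.
  by move=> q [Wq qm]; rewrite -(mem_inj qm muv).
Qed.

Lemma quot_hausdorff : tclosed N -> hausdorff Q.
Proof.
move=> cN x y nxy.
(* The inverses turn the [u * v^-1] of the continuity axiom into the left quotient that defines the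
   cosets. *)
have [|A [B [oA [oB [Ax [By hAB]]]]]] :=
    topen_div tg cN (x := (qrep x)^-1) (y := (qrep y)^-1).
  rewrite tgE => Nxy; apply: nxy; apply: (mem_inj _ (mem_rep y)).
  exact: rel_mem (mem_rep x) Nxy.
exists (fun q => exists2 z, A (z^-1) & mem q z).
exists (fun q => exists2 z, B (z^-1) & mem q z).
split; first exact: quot_open_image (topenV tg oA).
split; first exact: quot_open_image (topenV tg oB).
split; first by exists (qrep x) => //; apply: mem_rep.
split; first by exists (qrep y) => //; apply: mem_rep.
move=> q [[u Au qu] [v Bv qv]]; apply: (hAB _ _ Au Bv).
by rewrite tgE; apply: mem_rel qu qv.
Qed.

Lemma quot_compact : tcompact G -> tclosed K -> tcompact Q.
Proof.
move=> cpt cK F oF hF.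
pose lifts (S : Q -> Prop) U :=
  topen U /\ forall y, K y -> ((exists q, S q /\ mem q y) <-> U y).
(* The lifted open sets cover only [K], so its open complement completes the cover of [G]. *)
have [||l [lF lc]] := @cpt (fun U => (U = fun x => ~ K x) \/
    exists S, F S /\ lifts S U).
- by move=> U [->|[S [_ []]]].
- move=> x; case: (pselect (K x)) => Kx; last first.
    by exists (fun x => ~ K x); split; [left|].
  have [q qx] := mem_ex Kx; have [S [FS Sq]] := hF q.
  have /quot_openE [U [oU hU]] := oF S FS.
  exists U; split; first by right; exists S.
  by apply/hU => //; exists q.
suff [m mF ml] : exists2 m : list (Q -> Prop), (forall S, In S m -> F S) &
    forall U x, In U l -> U x -> K x -> exists q S, [/\ mem q x, In S m & S q].
  exists m; split=> // q; have [U [lU Ux]] := lc (qrep q).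
  have [r [S [mr mS Sr]]] := ml U _ lU Ux (qrep_in q).
  by exists S; split=> //; rewrite (mem_inj (mem_rep q) mr).
elim: l lF {lc} => [|U l IH] lF; first by exists [::].
have [V lV|m mF ml] := IH; first by apply: lF; right.
have [UK|[S [FS [_ hS]]]] := lF U (or_introl erefl).
  exists m => // W x [<-|lW] Wx Kx; first by rewrite UK in Wx.
  exact: ml lW Wx Kx.
exists (S :: m) => [S' [<-|/mF]|W x [<-|lW] Wx Kx] //.
  by have /(hS x Kx) [q [Sq qx]] := Wx; exists q, S; split=> //; left.
by have [q [S' [qx mS' Sq]]] := ml _ _ lW Wx Kx; exists q, S'; split=> //; right.
Qed.

Lemma quot_sfinite (L : Q -> Prop) :
  sfinite L <-> finite_over (fun x => exists2 q, L q & mem q x) N.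
Proof.
split=> -[l lP].
  exists (map (fun q : Q => qrep q) l) => x [q Lq qx].
  exists (qrep q); last exact: mem_rel (mem_rep q) qx.
  exact: (in_map (fun q : Q => qrep q)) (lP q Lq).
have /choice [f fP] : forall y, exists q : Q, K y -> mem q y.
  move=> y; case: (pselect (K y)) => [/mem_ex [q qy]|]; first by exists q.
  by exists (tone Q).
exists (map f l) => q Lq; have [|y ly Ny] := lP (qrep q).
  by exists q => //; apply: mem_rep.
have qy : mem q y by apply: (rel_mem (mem_rep q)); apply: (sub_divC tg sN).
by rewrite (mem_inj qy (fP y (mem_K qy))); apply: in_map.
Qed.

End QuotientBasics.

(** * Automorphisms, irreducibility and maps of quotients *)

Section QuotientMaps.
Variable G : tgroup.
Hypothesis tg : is_topgroup G.
Local Notation "x * y" := (@tmul G x y).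
Local Notation "x ^-1" := (@tinv G x).
Local Notation "1" := (tone G).

Section Aut.
Variables K N : G -> Prop.
Hypotheses (hK : subgrp K) (sN : subgrp N) (nNK : normal_in N K).
Local Notation Q := (quot N hK).
Let mem := (@mem G K N hK).
Variable a : G -> G.
Hypotheses (aK : forall x, K x -> K (a x)) (aN : forall x, N x -> N (a x)).
Hypotheses (ha : hom a).
Local Notation qa := (qaut N hK aK).

Lemma mem_aut (q : Q) x : mem q x -> mem (qa q) (a x).
Proof.
move=> qx; apply: (rel_mem tg sN (mem_qmk tg hK sN _)).
by rewrite -(homV tg ha) -ha; apply/aN/(mem_rel tg sN (mem_rep tg sN q) qx).
Qed.

Lemma mem_iter_aut n (q : Q) x : mem q x -> mem (iter n qa q) (iter n a x).
Proof. by move=> qx; elim: n => //= n; apply: mem_aut. Qed.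

Lemma qaut_hom : hom qa.
Proof.
move=> x y; have mx := mem_rep tg sN x; have my := mem_rep tg sN y.
apply: (mem_inj tg sN (mem_aut (mem_mul tg sN nNK mx my))).
by rewrite ha; apply: (mem_mul tg sN nNK); apply: mem_aut.
Qed.

Lemma qaut_cont : tcontinuous a -> tcontinuous qa.
Proof.
move=> ca U /(quot_openE tg sN) [W [oW hW]]; apply/(quot_openE tg sN).
exists (fun x => W (a x)); split; first exact: ca.
move=> y Ky; rewrite -(hW _ (aK Ky)); split=> [[q [Uq qy]]|[q [Uq qy]]].
  by exists (qa q); split=> //; apply: mem_aut.
have [r ry] := mem_ex tg hK sN Ky; exists r; split=> //.
by rewrite (mem_inj tg sN (mem_aut ry) qy).
Qed.

Lemma quot_transitive : topo_transitive_sub a K -> topo_transitive qa.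
Proof.
move=> [x [Kx tr]]; have [q qx] := mem_ex tg hK sN Kx.
exists q => U /(quot_openE tg sN) [W [oW hW]] [r Ur].
have [|z [o [Kz Wz]]] := tr W oW.
  have Kr := qrep_in r; exists (qrep r); split=> //; apply/hW => //.
  by exists r; split=> //; apply: mem_rep.
have /hW [//|s [Us sz]] := Wz.
exists s; split=> //; case: o => n [e|e]; exists n; [left|right].
  by apply: (mem_inj tg sN (mem_iter_aut n qx)); rewrite e.
by apply: (mem_inj tg sN (mem_iter_aut n sz)); rewrite e.
Qed.

End Aut.

Section Irreducible.
Variables K N : G -> Prop.
Hypotheses (hK : subgrp K) (sN : subgrp N) (nNK : normal_in N K).
Local Notation Q := (quot N hK).
Variables a b : G -> G.
Hypotheses (aK : forall x, K x -> K (a x)) (bK : forall x, K x -> K (b x)).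
Hypotheses (aN : forall x, N x -> N (a x)) (bN : forall x, N x -> N (b x)).
Hypotheses (ha : hom a) (hb : hom b) (ab : cancel a b) (ba : cancel b a).
Local Notation qa := (qaut N hK aK).
Local Notation qb := (qaut N hK bK).

Lemma qaut_is_aut : tcontinuous a -> tcontinuous b -> is_aut qa.
Proof.
move=> ca cb; split; first exact: qaut_hom.
split; first exact: qaut_cont.
exists qb; split; last split; last exact: qaut_cont.
- move=> q; have qr := mem_rep tg sN q.
  have := mem_aut sN bK bN hb (mem_aut sN aK aN ha qr).
  by rewrite ab => qr'; apply: (mem_inj tg sN qr').
- move=> q; have qr := mem_rep tg sN q.
  have := mem_aut sN aK aN ha (mem_aut sN bK bN hb qr).
  by rewrite ba => qr'; apply: (mem_inj tg sN qr').
Qed.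

Lemma finite_over_K : finite_over K N <-> sfinite (fun _ : Q => True).
Proof.
rewrite quot_sfinite //; split=> -[l lP]; exists l => x.
  by move=> [q _ qx]; apply: lP; apply: mem_K qx.
by move=> Kx; apply: lP; have [q] := mem_ex tg hK sN Kx; exists q.
Qed.

(** Irreducibility of [K/N] expressed by subgroups of [G] between [N] and [K], so that chains can be
    studied without forming quotients. *)
Definition irreducible_section : Prop :=
  ~ finite_over K N /\
  forall A, closed_subgroup A -> (forall x, N x -> A x) -> normal_in A K ->
    (forall x, A x -> A (a x)) -> (forall x, A x -> A (b x)) ->
    (exists x, K x /\ ~ A x) -> finite_over A N.

Lemma irreducible_quotE : tcompact Q -> tclosed K ->
  irreducible qa <-> irreducible_section.
Proof.
move=> cQ cK; split.
  move=> [_ [inf irr]]; split; first by move=> /finite_over_K.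
  move=> A [sA cA] NA nA Aa Ab [x [Kx nAx]].
  pose L (q : Q) := exists2 x, A x & mem q x.
  have LA q y : L q -> mem q y -> A y.
    by move=> [z Az qz] qy; apply: (subMl tg sA Az); apply/NA/(mem_rel tg sN qz qy).
  have [||||l lP] := irr L.
  - split; [split; last split|].
    + by exists 1; [apply: sub1 | apply/mem_one => //; apply: sub1].
    + move=> p q [y Ay py] [z Az qz]; exists (y * z); first exact: subM.
      exact: mem_mul.
    + by move=> q [y Ay qy]; exists (y^-1); [apply: subV | apply: mem_inv].
    + apply/quot_openE => //; exists (fun x => ~ A x); split=> // y Ky; split.
        by move=> [q [nLq qy]] Ay; apply: nLq; exists y.
      move=> nAy; have [q qy] := mem_ex tg hK sN Ky; exists q; split=> //.
      by move=> /LA /(_ qy).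
  - split=> // k q _ [y Ay qy]; exists ((qrep k)^-1 * y * qrep k).
      by apply: (proj2 nA) => //; apply: qrep_in.
    have kr := mem_rep tg sN k.
    by apply: mem_mul => //; apply: mem_mul => //; apply: mem_inv.
  - split=> [q [y Ay qy]|q [y Ay qy]].
      by exists (a y); [apply: Aa | apply: mem_aut].
    have [r ry] := mem_ex tg hK sN (bK (mem_K tg nNK qy)).
    exists r; split; first by exists (b y) => //; apply: Ab.
    by have := mem_aut sN aK aN ha ry; rewrite ba => h; apply: (mem_inj tg sN h).
  - by have [q qx] := mem_ex tg hK sN Kx; exists q => /LA /(_ qx).
  have /quot_sfinite [] // : sfinite L by exists l.
  move=> m mP; exists m => y Ay; apply: mP.
  by have [q qy] := mem_ex tg hK sN (proj1 nA _ Ay); exists q => //; exists y.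
move=> [inf irr]; split=> //; split; first by move=> /finite_over_K.
move=> L [sL cL] nL [La Lb] [q0 nLq0].
pose A x := exists2 q : Q, L q & mem q x.
have AK x : A x -> K x by move=> [q _ /(mem_K tg nNK)].
apply/quot_sfinite => //; apply: (irr A).
- split; [split; last split|].
  + by exists (tone Q); [apply: sub1 | apply/mem_one => //; apply: sub1].
  + move=> x y [q Lq qx] [r Lr ry]; exists (tmul q r); first exact: subM.
    exact: mem_mul.
  + by move=> x [q Lq qx]; exists (tinv q); [apply: subV | apply: mem_inv].
  + have /(quot_openE tg sN) [U [oU hU]] := cL.
    (* [U] describes the complement of [L] only on [K], hence the intersection with the closed
       [K]. *)
    apply: (tclosed_ext (A := fun x => K x /\ ~ U x)).
      move=> x; split=> [[Kx nUx]|[q Lq qx]].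
        have [q qx] := mem_ex tg hK sN Kx; exists q => //.
        by apply: contrapT => nLq; apply/nUx/hU => //; exists q.
      have Kx := mem_K tg nNK qx; split=> // /(hU x Kx) [r [nLr rx]].
      by apply: nLr; rewrite (mem_inj tg sN rx qx).
    apply: (tclosedI tg cK).
    by apply: topen_ext oU => x; split=> [? []|/contrapT].
- move=> x Nx; exists (tone Q); first exact: sub1.
  exact/mem_one.
- split=> // k x Kk [q Lq qx]; have [r rk] := mem_ex tg hK sN Kk.
  exists (tmul (tmul (tinv r) q) r); first by apply: (proj2 nL).
  by apply: mem_mul => //; apply: mem_mul => //; apply: mem_inv.
- by move=> x [q Lq qx]; exists (qa q); [apply: La | apply: mem_aut].
- move=> x [q Lq qx]; have [r [Lr rq]] := Lb _ Lq; exists r => //.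
  have rr := mem_rep tg sN r; apply: (rel_mem tg sN rr).
  have := mem_rel tg sN (mem_aut sN aK aN ha rr) (x := a (qrep r)) (y := x).
  by rewrite rq => /(_ qx)/bN; rewrite hb (homV tg hb) ab.
- exists (qrep q0); split; first exact: qrep_in.
  by move=> [q Lq qr]; apply: nLq0; rewrite (mem_inj tg sN (mem_rep tg sN q0) qr).
Qed.

End Irreducible.

(** The map is induced by the inclusion of [K] in [K1]; its kernel is the image of the intersection
    of [K] and [N1]. *)
Lemma quot_map (a : G -> G) (K N K1 N1 : G -> Prop)
  (hK : subgrp K) (hK1 : subgrp K1)
  (aK : forall x, K x -> K (a x)) (aK1 : forall x, K1 x -> K1 (a x)) :
  hom a -> subgrp N -> subgrp N1 -> normal_in N K -> normal_in N1 K1 ->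
  (forall x, N x -> N (a x)) -> (forall x, N1 x -> N1 (a x)) ->
  (forall x, K x -> K1 x) -> (forall x, N x -> N1 x) ->
  (forall x, K1 x -> exists2 y, K y & N1 (x^-1 * y)) ->
  finite_over (fun x => K x /\ N1 x) N ->
  exists f : quot N hK -> quot N1 hK1,
    [/\ forall x y, f (tmul x y) = tmul (f x) (f y),
        forall U, topen U -> topen (fun x => U (f x)),
        forall y, exists x, f x = y,
        sfinite (fun x => f x = tone (quot N1 hK1)) &
        forall h, f (qaut N hK aK h) = qaut N1 hK1 aK1 (f h)].
Proof.
move=> ha sN sN1 nN nN1 aN aN1 KK1 NN1 surj fin.
pose f (q : quot N hK) : quot N1 hK1 := qmk N1 (KK1 _ (qrep_in q)).
have fE q x : mem q x -> mem (f q) x.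
  move=> qx; apply: (rel_mem tg sN1 (mem_qmk tg hK1 sN1 _)).
  exact/NN1/(mem_rel tg sN (mem_rep tg sN q) qx).
exists f; split.
- move=> x y; have mx := mem_rep tg sN x; have my := mem_rep tg sN y.
  apply: (mem_inj tg sN1 (fE _ _ (mem_mul tg sN nN mx my))).
  by apply: mem_mul => //; apply: fE.
- move=> U /(quot_openE tg sN1) [W [oW hW]]; apply/(quot_openE tg sN).
  exists W; split=> // y Ky; rewrite -(hW _ (KK1 _ Ky)).
  split=> [[q [Uq qy]]|[q [Uq qy]]]; first by exists (f q); split=> //; apply: fE.
  have [r ry] := mem_ex tg hK sN Ky; exists r; split=> //.
  by rewrite (mem_inj tg sN1 (fE _ _ ry) qy).
- move=> q; have [y Ky Ny] := surj _ (qrep_in q).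
  have [r ry] := mem_ex tg hK sN Ky; exists r.
  exact: (mem_inj tg sN1 (fE _ _ ry) (rel_mem tg sN1 (mem_rep tg sN1 q) Ny)).
- apply/quot_sfinite => //; case: fin => l lP; exists l => x [q fq qx].
  apply: lP; split; first exact: mem_K qx.
  by apply/(mem_one tg hK1 sN1); rewrite -fq; apply: fE.
- move=> h; have hr := mem_rep tg sN h.
  apply: (mem_inj tg sN1 (fE _ _ (mem_aut sN aK aN ha hr))).
  by apply: mem_aut => //; apply: fE.
Qed.

End QuotientMaps.

(** * Uniqueness *)

Section FiniteOver.
Variable G : tgroup.
Hypothesis tg : is_topgroup G.
Local Notation "x * y" := (@tmul G x y).
Local Notation "x ^-1" := (@tinv G x).
Local Notation "1" := (tone G).
Let tgE := tgE tg.
Implicit Types A B N : G -> Prop.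

Lemma finite_over_sub A B N :
  (forall x, A x -> B x) -> finite_over B N -> finite_over A N.
Proof. by move=> AB [l lP]; exists l => x /AB /lP. Qed.

Lemma finite_over_reps A B : subgrp B -> finite_over A B ->
  exists l : list G, forall x, A x ->
    exists y, [/\ In y l, A y & B (y^-1 * x)].
Proof.
move=> sB [l lP].
have /choice [f fP] : forall g, exists y, (exists2 y, A y & B (g^-1 * y)) ->
    A y /\ B (g^-1 * y).
  move=> g; case: (pselect (exists2 y, A y & B (g^-1 * y))) => [[y Ay By]|no].
    by exists y.
  by exists 1.
exists (map f l) => x Ax; have [g lg Bg] := lP x Ax.
have [|Af Bf] := fP g; first by exists x.
exists (f g); split=> //; first exact: in_map.
exact: (sub_div_trans tg sB (sub_divC tg sB Bf) Bg).
Qed.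

Lemma finite_over_trans A B N : subgrp A -> subgrp B -> finite_over A B ->
  finite_over (fun x => A x /\ B x) N -> finite_over A N.
Proof.
move=> sA sB /(finite_over_reps sB) [l lP] [m mP].
exists (flat_map (fun y => map (fun z => y * z) m) l) => x Ax.
have [y [ly Ay By]] := lP x Ax.
have [|z mz Nz] := mP (y^-1 * x); first by split=> //; apply: sub_div.
exists (y * z); last by move: Nz; rewrite !tgE.
by apply/in_flat_map; exists y; split=> //; apply/in_map_iff; exists z.
Qed.

Lemma finite_over_cap A B N : subgrp A -> subgrp B -> finite_over A B ->
  (forall x, A x -> B x -> N x) -> finite_over A N.
Proof.
move=> sA sB /(finite_over_reps sB) [l lP] BN; exists l => x Ax.
have [y [ly Ay By]] := lP x Ax; exists y => //; apply: BN => //.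
exact: sub_div.
Qed.

(** The finitely many listed cosets of [N] other than [N] are closed and miss 1, so some ball avoids
    them all. *)
Lemma finite_over_open (a b : G -> G) V K N : expansive a b V ->
  subgrp N -> tclosed N -> finite_over K N ->
  exists n, forall x, K x -> ball a b V n x -> N x.
Proof.
move=> E sN cN [l lP].
suff [n hn] : exists n, forall x, ball a b V n x ->
    forall y, In y l -> N (y^-1 * x) -> N y.
  exists n => x Kx Bx; have [y ly Ny] := lP x Kx.
  exact: (subMl tg sN (hn x Bx y ly Ny) Ny).
elim: l {lP} => [|y l [n hn]]; first by exists 0 => x _ y [].
case: (pselect (N y)) => Ny.
  by exists n => x Bx z [<-|lz] // Nz; apply: hn lz Nz.
have [|m hm] := ball_base E (tclosedMl tg (y^-1) cN).
  by rewrite tgE => /(subVr tg sN).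
exists (m + n)%N => x Bx z [<-|lz] Nz.
  by case: (hm x) => //; apply: ball_le Bx; apply: leq_addr.
by apply: (hn x _ z lz Nz); apply: ball_le Bx; apply: leq_addl.
Qed.

Lemma mul_closed (a b : G -> G) V A B : expansive a b V ->
  tclosed A -> tclosed B -> tclosed (fun x => exists2 y, A y & B (y^-1 * x)).
Proof.
move=> E cA cB; have sU n := ball_sub E n.
apply: (tclosed_ballP E) => x hx.
have [n|n y [Ay [c [Bc Uc]]]|n|y hy] := decreasing_closed_meet (ex_cpt E)
  (C := fun n y => A y /\ exists c, B c /\ ball a b V n ((y^-1 * x)^-1 * c)).
- apply: (tclosedI tg cA); apply: (tclosed_cosets E (n := n)) => y z [c [Bc Uc]] Uyz.
  exists c; split=> //; have := subM (sU n) Uc (ball_norm E c Uyz).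
  by rewrite !tgE.
- by split=> //; exists c; split=> //; apply: ball_le Uc.
- have [w [y Ay Bw] Uw] := hx n.
  by exists y; split=> //; exists (y^-1 * w); split=> //; move: Uw; rewrite !tgE.
- exists y; first by have [] := hy 0.
  by apply: (closed_ball E cB) => n; have [_ [c [Bc Uc]]] := hy n; exists c.
Qed.

End FiniteOver.

(** * Matching the factors of two chains *)

Section Uniqueness.
Variables (G : tgroup) (a b : G -> G) (V : G -> Prop).
Hypothesis E : expansive a b V.
Local Notation "x * y" := (@tmul G x y).
Local Notation "x ^-1" := (@tinv G x).
Local Notation "1" := (tone G).
Let tg := ex_tg E.
Let tgE := tgE tg.

Record irreducible_chain (r : nat) (Gs : nat -> G -> Prop) : Prop := {
  ic_bot : forall x, Gs 0 x -> x = 1;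
  ic_top : forall x, Gs r x;
  ic_sc : forall j, j <= r -> stable_closed a b (Gs j);
  ic_normal : forall j, j < r -> normal_in (Gs j) (Gs j.+1);
  ic_irr : forall j, j < r -> irreducible_section (Gs j.+1) (Gs j) a b }.

Lemma chain_le r (Gs : nat -> G -> Prop) i j x : irreducible_chain r Gs ->
  i <= j <= r -> Gs i x -> Gs j x.
Proof.
move=> cG /andP[ij]; rewrite -(subnK ij); elim: (j - i) => // k IH kr Gx.
by apply: (proj1 (ic_normal cG kr)); apply: IH => //; apply: ltnW.
Qed.

(** The image of [Hs i] in the factor [Gs j.+1 / Gs j] is the whole factor. *)
Definition covers (Gs Hs : nat -> G -> Prop) j i : Prop :=
  forall x, Gs j.+1 x -> exists2 y, Gs j.+1 y /\ Hs i y & Gs j (y^-1 * x).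

(* The factors number j of Gs and number i of Hs match when the image of
   [Hs i] in the former jumps from finite to everything at the step i -> i.+1. *)
Definition matching r (Gs : nat -> G -> Prop) s (Hs : nat -> G -> Prop) j i :=
  [/\ j < r, i < s, covers Gs Hs j i.+1 &
      finite_over (fun x => Gs j.+1 x /\ Hs i x) (Gs j)].

Section Matching.
Variables (r : nat) (Gs : nat -> G -> Prop) (s : nat) (Hs : nat -> G -> Prop).
Hypotheses (cG : irreducible_chain r Gs) (cH : irreducible_chain s Hs).
Let sG j (jr : j <= r) := sc_sub (ic_sc cG jr).
Let sH j (js : j <= s) := sc_sub (ic_sc cH js).

Lemma covers_infinite j i : j < r -> covers Gs Hs j i ->
  ~ finite_over (fun x => Gs j.+1 x /\ Hs i x) (Gs j).
Proof.
move=> jr cov [l lP]; case: (ic_irr cG jr) => + _; apply; exists l => x /cov [y hy Ny].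
have [z lz Nz] := lP y hy; exists z => //.
exact: (sub_div_trans tg (sG (ltnW jr)) Nz Ny).
Qed.

(** The image of [Hs i] is normalised by that of [Hs i.+1], which is the whole factor; it is
    therefore closed, normal and stable, and irreducibility leaves only the two alternatives. *)
Lemma covers_step j i : j < r -> i < s -> covers Gs Hs j i.+1 ->
  covers Gs Hs j i \/ finite_over (fun x => Gs j.+1 x /\ Hs i x) (Gs j).
Proof.
move=> jr js cov.
have sN := sG (ltnW jr); have sK := sG jr; have nN := ic_normal cG jr.
have sHi := sH (ltnW js); have nH := ic_normal cH js.
pose A x := exists2 y, Gs j.+1 y /\ Hs i y & Gs j (y^-1 * x).
have sKH : subgrp (fun y => Gs j.+1 y /\ Hs i y) by apply: subgrpI.
have AK x : A x -> Gs j.+1 x.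
  by move=> [y [Ky _] /(proj1 nN)]; apply: (subMl tg sK).
have HA x : Gs j.+1 x /\ Hs i x -> A x.
  by move=> hx; exists x => //; rewrite tgE; apply: sub1.
have KA x : Gs j x -> A x.
  by move=> Nx; exists 1; [exact: (sub1 sKH) | rewrite !tgE].
have autA f : hom f -> (forall j, j <= r -> forall x, Gs j x -> Gs j (f x)) ->
    (forall j, j <= s -> forall x, Hs j x -> Hs j (f x)) ->
    forall x, A x -> A (f x).
  move=> hf fG fH x [y [Ky Hy] Ny]; exists (f y).
    by split; [apply: fG | apply: fH => //; apply: ltnW].
  by rewrite -(homV tg hf) -hf; apply: fG => //; apply: ltnW.
case: (pselect (exists x, Gs j.+1 x /\ ~ A x)) => [pA|nA]; last first.
  by left=> x Kx; apply: contrapT => nAx; apply: nA; exists x; split.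
right; apply: (finite_over_sub HA).
case: (ic_irr cG jr) => _; apply=> //.
- split; last first.
    apply: (mul_closed tg E); last exact: (sc_closed (ic_sc cG (ltnW jr))).
    exact: (tclosedI tg (sc_closed (ic_sc cG jr)) (sc_closed (ic_sc cH (ltnW js)))).
  split; first by apply: KA; apply: sub1.
  split=> [x y [u hu Nu] [v hv Nv]|x [u hu Nu]].
    exists (u * v); first exact: (subM sKH hu hv).
    have := subM sN (proj2 nN _ _ (proj1 hv) Nu) Nv.
    by rewrite !tgE.
  exists (u^-1); first exact: (subV sKH hu).
  have := normalJ tg nN sK (proj1 hu) (subV sN Nu).
  by rewrite !tgE.
- split=> // k x Kk [y [Ky Hy] Ny].
  (* Modulo [Gs j] the element [k] may be replaced by [u] in [Hs i.+1], which normalises [Hs i]. *)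
  have [u [Ku Hu] Nu] := cov k Kk.
  exists (u^-1 * y * u).
    split; last exact: (proj2 nH).
    by apply: (subM sK) => //; apply: sub_div.
  have N1 := normalJ tg nN sK Ku (subV sN Nu).
  have N2 := proj2 nN _ _ (subM sK Ky Ku) N1.
  have N3 := subM sN (subM sN N2 (proj2 nN _ _ Ku Ny)) Nu.
  by move: N3; rewrite !tgE.
- apply: autA => [|i' hi x|i' hi x]; first exact: ex_homa E.
    exact: (sc_a (ic_sc cG hi)).
  exact: (sc_a (ic_sc cH hi)).
- apply: autA => [|i' hi x|i' hi x]; first exact: ex_homb E.
    exact: (sc_b (ic_sc cG hi)).
  exact: (sc_b (ic_sc cH hi)).
Qed.

(** The least index at which the image is everything is positive, since [Hs 0] is trivial and the
    factor infinite; one step before, the image is finite by [covers_step]. *)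
Lemma matching_ex j : j < r -> exists i, matching r Gs s Hs j i.
Proof.
move=> jr.
have sN := sG (ltnW jr).
have cov0 : ~ covers Gs Hs j 0.
  move=> /(covers_infinite jr); apply; exists [:: 1] => x [_ /(ic_bot cH) ->].
  by exists 1; [left | rewrite !tgE; exact: (sub1 sN)].
have ex : exists i, `[< covers Gs Hs j i >].
  exists s; apply/asboolP => x Kx; exists x; last by rewrite tgE; exact: (sub1 sN).
  by split=> //; apply: (ic_top cH).
have [i /asboolP ci min] := ex_minnP ex.
case: i ci min => // i ci min; exists i.
have js : i < s.
  apply: min; apply/asboolP => x Kx; exists x; last by rewrite tgE; exact: (sub1 sN).
  by split=> //; apply: (ic_top cH).
split=> //; case: (covers_step jr js ci) => // ci'.
by have := min i; rewrite ltnn => h; have := h (introT (asboolP _) ci').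
Qed.

Lemma matching_uniq j i i' : matching r Gs s Hs j i -> matching r Gs s Hs j i' ->
  i = i'.
Proof.
wlog lt : i i' / i < i' => [th mi mi'|].
  by case: (ltngtP i i') => // lt; [apply: th | symmetry; apply: th].
move=> [jr _ ci _] [_ js _ fi]; exfalso.
apply: (covers_infinite jr ci); apply: finite_over_sub fi => x [Kx Hx]; split=> //.
by apply: (chain_le cH _ Hx); rewrite lt ltnW.
Qed.

End Matching.

Section MatchingSym.
Variables (r : nat) (Gs : nat -> G -> Prop) (s : nat) (Hs : nat -> G -> Prop).
Hypotheses (cG : irreducible_chain r Gs) (cH : irreducible_chain s Hs).
Let sG j (jr : j <= r) := sc_sub (ic_sc cG jr).
Let sH j (js : j <= s) := sc_sub (ic_sc cH js).

Lemma matching_sym j i : matching r Gs s Hs j i -> matching s Hs r Gs i j.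
Proof.
move=> [jr js cov fin].
have sN := sG (ltnW jr); have sK := sG jr; have nN := ic_normal cG jr.
have sHi := sH (ltnW js); have sHi1 := sH js; have nH := ic_normal cH js.
have [j' m'] := matching_ex cH cG js.
have [_ jr' cov' fin'] := m'.
case: (ltngtP j j') => [lt|lt|->] //; exfalso; last first.
  (* Case [j' < j]: then [Gs j'.+1] lies in [Gs j], so modulo [Gs j] the groups [Hs i.+1] and [Hs i]
     have the same image, which is full and finite at once. *)
  apply: (covers_infinite cG jr (i := i)); last exact: fin.
  move=> x /cov [y [Ky Hy] Ny].
  have [u [Hu Gu] Hv] := cov' y Hy.
  have Nu : Gs j u by apply: (chain_le cG _ Gu); rewrite lt ltnW.
  exists (u^-1 * y); first by split=> //; apply: (sub_div sK) => //; apply: (proj1 nN).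
  have := subM sN (proj2 nN _ _ Ky Nu) Ny.
  by rewrite !tgE.
(* Case [j < j']: then [Gs j.+1] lies in [Gs j'], so its intersection with [Hs i.+1] is finite over
   [Hs i], and what remains in [Hs i] is finite over [Gs j]; but the image should be infinite. *)
apply: (covers_infinite cG jr cov).
apply: (finite_over_trans tg (B := Hs i)) => //; first exact: subgrpI.
  apply: finite_over_sub fin' => x [Kx Hx]; split=> //.
  by apply: (chain_le cG _ Kx); rewrite lt ltnW.
by apply: finite_over_sub fin => x [[]].
Qed.

Lemma matching_cocommensurable j i : matching r Gs s Hs j i ->
  forall (hK : subgrp (Gs j.+1)) (hS : forall x, Gs j.+1 x -> Gs j.+1 (a x))
         (hK' : subgrp (Hs i.+1)) (hS' : forall x, Hs i.+1 x -> Hs i.+1 (a x)),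
  cocommensurable (qaut (Gs j) hK hS) (qaut (Hs i) hK' hS').
Proof.
move=> m hK hS hK' hS'.
have [js jr cov' fin'] := matching_sym m.
have [_ _ cov fin] := m.
have [gG gH] := (ic_sc cG (ltnW jr), ic_sc cH (ltnW js)).
have [gG1 gH1] := (ic_sc cG jr, ic_sc cH js).
have nN := ic_normal cG jr; have nH := ic_normal cH js.
pose K x := Gs j.+1 x /\ Hs i.+1 x; pose N x := Gs j x /\ Hs i x.
have sK : subgrp K by apply: subgrpI.
have sN : subgrp N by apply: subgrpI; [apply: sc_sub gG | apply: sc_sub gH].
have nNK : normal_in N K.
  split=> [x [Gx Hx]|k x [Gk Hk] [Gx Hx]].
    by split; [apply: (proj1 nN) | apply: (proj1 nH)].
  by split; [apply: (proj2 nN) | apply: (proj2 nH)].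
have aK x : K x -> K (a x) by case=> Gx Hx; split; [apply: hS | apply: hS'].
have bK x : K x -> K (b x).
  by case=> Gx Hx; split; [apply: (sc_b gG1) | apply: (sc_b gH1)].
have aN x : N x -> N (a x).
  by case=> Gx Hx; split; [apply: (sc_a gG) | apply: (sc_a gH)].
have bN x : N x -> N (b x).
  by case=> Gx Hx; split; [apply: (sc_b gG) | apply: (sc_b gH)].
have sKG : subgrp (fun x => K x /\ Gs j x) by apply: subgrpI => //; apply: sc_sub gG.
have sKH : subgrp (fun x => K x /\ Hs i x) by apply: subgrpI => //; apply: sc_sub gH.
exists (quot N sK); split; first exact: quot_topgroup.
split.
  apply: quot_hausdorff => //.
  by apply: tclosedI => //; [apply: sc_closed gG | apply: sc_closed gH].
split.
  apply: quot_compact => //; first exact: ex_cpt E.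
  by apply: tclosedI => //; [apply: sc_closed gG1 | apply: sc_closed gH1].
exists (qaut N sK aK); split.
  apply: (qaut_is_aut tg sK sN nNK aK bK aN bN (ex_homa E) (ex_homb E)
    (ex_ab E) (ex_ba E) (ex_conta E) (ex_contb E)).
have [|||||f1 [f1M f1c f1s f1k f1a]] := @quot_map G tg a K N (Gs j.+1) (Gs j)
    sK hK aK hS (ex_homa E) sN (sc_sub gG) nNK nN aN.
- exact: (sc_a gG).
- by move=> x [].
- by move=> x [].
- move=> x Kx; have [y [Ky Hy] Ny] := cov x Kx; exists y => //.
  exact: (sub_divC tg (sc_sub gG)).
(* The kernel comes from points of [Gs j] and [Hs i.+1], which are finite over [Hs i] by the
   symmetric matching. *)
- apply: (finite_over_cap tg (B := Hs i)) => //; first exact: sc_sub gH.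
    by apply: finite_over_sub fin' => x [[_ ?] ?].
  by move=> x [_ ?] ?.
have [|||||f2 [f2M f2c f2s f2k f2a]] := @quot_map G tg a K N (Hs i.+1) (Hs i)
    sK hK' aK hS' (ex_homa E) sN (sc_sub gH) nNK nH aN.
- exact: (sc_a gH).
- by move=> x [].
- by move=> x [].
- move=> x Kx; have [y [Ky Hy] Ny] := cov' x Kx; exists y => //.
  exact: (sub_divC tg (sc_sub gH)).
- apply: (finite_over_cap tg (B := Gs j)) => //; first exact: sc_sub gG.
    by apply: finite_over_sub fin => x [[? _] ?].
  by move=> x [_ ?] ?.
by exists f1, f2.
Qed.

End MatchingSym.

Lemma irreducible_chains_equivalent r Gs s Hs :
  irreducible_chain r Gs -> irreducible_chain s Hs ->
  equivalent_series a r Gs s Hs.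
Proof.
move=> cG cH.
have mk r' Gs' s' Hs' : irreducible_chain r' Gs' -> irreducible_chain s' Hs' ->
    exists f : 'I_r' -> 'I_s', forall j : 'I_r', matching r' Gs' s' Hs' j (f j).
  move=> cG' cH'.
  have /choice [f fP] : forall j : 'I_r', exists i : 'I_s', matching r' Gs' s' Hs' j i.
    move=> j; have [i m] := matching_ex cG' cH' (ltn_ord j).
    by have [_ js _ _] := m; exists (Ordinal js).
  by exists f.
have [f fP] := mk _ _ _ _ cG cH; have [g gP] := mk _ _ _ _ cH cG.
have fK : cancel f g.
  move=> j; apply: val_inj; apply: (matching_uniq cH cG (gP (f j))).
  exact: (matching_sym cG cH (fP j)).
have gK : cancel g f.
  move=> j; apply: val_inj; apply: (matching_uniq cG cH (fP (g j))).
  exact: (matching_sym cH cG (gP j)).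
have rs : r = s by have := bij_eq_card (Bijective fK gK); rewrite !card_ord.
split=> //; subst s; exists (perm (can_inj fK)) => j hK hS hK' hS'.
have := fP j; rewrite -(permE (can_inj fK)) => m.
exact: (matching_cocommensurable cG cH m).
Qed.

End Uniqueness.

(** * Existence *)

Section Existence.
Variables (G : tgroup) (a b : G -> G) (V : G -> Prop).
Hypothesis E : expansive a b V.
Local Notation "x * y" := (@tmul G x y).
Local Notation "x ^-1" := (@tinv G x).
Local Notation "1" := (tone G).
Let tg := ex_tg E.
Let tgE := tgE tg.

Record strict_chain (r : nat) (Gs : nat -> G -> Prop) : Prop := {
  st_bot : forall x, Gs 0 x <-> x = 1;
  st_top : forall x, Gs r x;
  st_sc : forall j, j <= r -> stable_closed a b (Gs j);
  st_trans : forall j, j <= r -> topo_transitive_sub a (Gs j);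
  st_normal : forall j, j < r -> normal_in (Gs j) (Gs j.+1);
  st_strict : forall j, j < r -> exists x, Gs j.+1 x /\ ~ Gs j x }.

(** Each strict step raises the depth, which is at most twice the number of listed cosets of [V]. *)
Lemma strict_chain_bound : exists B, forall r Gs, strict_chain r Gs -> r <= B.
Proof.
have [l lP] := open_subgroup_reps tg (ex_cpt E) (ex_sub E) (ex_open E).
exists (size l + size l)%N => r Gs cG.
suff h j : j <= r -> j <= depth a b V l (Gs j).
  by apply: (leq_trans (h r (leqnn r))); apply: depth_bound.
elim: j => // j IH jr; apply: leq_ltn_trans (IH (ltnW jr)) _.
apply: (depth_lt E lP (st_sc cG (ltnW jr)) (st_sc cG jr) (st_trans cG jr)).
  exact: (proj1 (st_normal cG jr)).
exact: (st_strict cG jr).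
Qed.

Lemma stable_closed1 : stable_closed a b (fun x => x = 1).
Proof.
split; [split; [|split] | | |] => //.
- by move=> x y -> ->; rewrite tgE.
- by move=> x ->; rewrite tgE.
- apply: (tclosed_ballP E) => x hx.
  rewrite -(tinvK tg x) (_ : x^-1 = 1) ?tgE //; apply: (ball_sep E) => n.
  by have [y -> ] := hx n; rewrite tgE.
- by move=> x ->; apply: (hom1 tg (ex_homa E)).
- by move=> x ->; apply: (hom1 tg (ex_homb E)).
Qed.

Lemma stable_closedT : stable_closed a b (fun _ => True).
Proof.
split=> //; apply: topen_ext (topen_bigU tg (F := fun _ => False) _) => // x.
by split=> [[U []]|].
Qed.

Lemma topo_transitive1 : topo_transitive_sub a (fun x => x = 1).
Proof.
exists 1; split=> // U oU [y [-> U1]]; exists 1; split=> //.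
by exists 0; left.
Qed.

Lemma strict_chain_ex : topo_transitive a -> exists r Gs, strict_chain r Gs.
Proof.
move=> tG; case: (pselect (forall x : G, x = 1)) => triv.
  exists 0, (fun _ x => x = 1); split=> // j _.
    exact: stable_closed1.
  exact: topo_transitive1.
exists 1%N, (fun j x => if j is 0 then x = 1 else True); split=> //.
- case=> [|j] _; [exact: stable_closed1 | exact: stable_closedT].
- case=> [|j] _; first exact: topo_transitive1.
  have [x hx] := tG; exists x; split=> // U oU [y [_ Uy]].
  by have [|z [o Uz]] := hx U oU; [exists y | exists z].
- case=> // _; split=> // k n _ ->.
  by rewrite !tgE.
- case=> // _; have /existsNP [x nx] := triv.
  by exists x.
Qed.

Lemma maximal_chain_ex : topo_transitive a -> exists r Gs, strict_chain r Gs /\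
  forall Gs', ~ strict_chain r.+1 Gs'.
Proof.
move=> /strict_chain_ex [r0 [Gs0 c0]].
have ex : exists r, `[< exists Gs, strict_chain r Gs >].
  by exists r0; apply/asboolP; exists Gs0.
have [B hB] := strict_chain_bound.
have ub r : `[< exists Gs, strict_chain r Gs >] -> r <= B.
  by move=> /asboolP [Gs]; apply: hB.
have [r /asboolP [Gs cG] max] := ex_maxnP ex ub.
exists r, Gs; split=> // Gs' c'.
by have := max r.+1; rewrite ltnn => h; have := h (introT (asboolP _) (ex_intro _ Gs' c')).
Qed.

Lemma strict_chain_refine r Gs j D : strict_chain r Gs -> j < r ->
  stable_closed a b D -> topo_transitive_sub a D ->
  normal_in (Gs j) D -> normal_in D (Gs j.+1) ->
  (exists x, D x /\ ~ Gs j x) -> (exists x, Gs j.+1 x /\ ~ D x) ->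
  exists Gs', strict_chain r.+1 Gs'.
Proof.
move=> cG jr sD tD nD nD' pD pD'.
pose Gs' i := if i <= j then Gs i else if i == j.+1 then D else Gs i.-1.
have lo i : i <= j -> Gs' i = Gs i by rewrite /Gs' => ->.
have mid : Gs' j.+1 = D by rewrite /Gs' ltnn eqxx.
have hi i : j < i -> Gs' i.+1 = Gs i.
  by move=> ji; rewrite /Gs' leqNgt ltnS (ltnW ji) eqSS gtn_eqF.
have step i : i < r.+1 -> normal_in (Gs' i) (Gs' i.+1) /\
    exists x, Gs' i.+1 x /\ ~ Gs' i x.
  rewrite ltnS => ir; case: (ltngtP i j) => ij.
  - rewrite !lo ?(ltnW ij) //; have ir' := ltn_trans ij jr.
    by split; [exact: (st_normal cG ir') | exact: (st_strict cG ir')].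
  - case: i ij ir => // i; rewrite ltnS leq_eqVlt => /predU1P [<-|ij] ir.
      by rewrite mid hi.
    rewrite !hi //; last exact: leqW.
    by split; [exact: (st_normal cG ir) | exact: (st_strict cG ir)].
  - by rewrite ij lo // mid.
have lev i : i <= r.+1 -> stable_closed a b (Gs' i) /\ topo_transitive_sub a (Gs' i).
  move=> ir; case: (leqP i j) => ij.
    have ir' := leq_trans ij (ltnW jr).
    by rewrite lo //; split; [exact: (st_sc cG ir') | exact: (st_trans cG ir')].
  case: i ij ir => // i; rewrite ltnS leq_eqVlt => /predU1P [<-|ij] ir.
    by rewrite mid.
  by rewrite hi //; split; [exact: (st_sc cG ir) | exact: (st_trans cG ir)].
exists Gs'; split.
- by rewrite lo //; apply: st_bot cG.
- by rewrite hi //; apply: st_top cG.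
- by move=> i /lev [].
- by move=> i /lev [].
- by move=> i /step [].
- by move=> i /step [].
Qed.

(** A finite factor would make [Gs j] open in the transitive [Gs j.+1], hence equal to it. For a
    proper [A], the core of [A] contains [Gs j] by [core_max], and maximal length forbids inserting
    it as a new term. *)
Lemma maximal_chain_irreducible r Gs : strict_chain r Gs ->
  (forall Gs', ~ strict_chain r.+1 Gs') ->
  forall j, j < r -> irreducible_section (Gs j.+1) (Gs j) a b.
Proof.
move=> cG max j jr; have sN := st_sc cG (ltnW jr); have sK := st_sc cG jr.
have nN := st_normal cG jr.
split=> [fin|A [sA cA] NA nA Aa Ab [x [Kx nAx]]].
  have [n hn] := finite_over_open tg E (sc_sub sN) (sc_closed sN) fin.
  have [x [Kx nNx]] := st_strict cG jr; apply: nNx.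
  exact: (transitive_le_open E (st_trans cG jr) (sc_sub sK) sN hn).
have scA : stable_closed a b A by [].
pose D := core a b V A.
have sD : stable_closed a b D by apply: core_stable_closed.
have DA x' : D x' -> A x' by apply: core_le.
have ND x' : Gs j x' -> D x'.
  exact: (core_max E scA (st_trans cG (ltnW jr)) (sc_sub sN) NA).
case: (pselect (exists x, D x /\ ~ Gs j x)) => [pD|nD].
  have [|||Gs' c'] := @strict_chain_refine r Gs j D cG jr sD (core_transitive E scA) _ _ pD.
  - split=> // k n Dk; apply: (proj2 nN); exact/(proj1 nA)/DA.
  - split=> [y /DA|k y Kk Dy]; first exact: (proj1 nA).
    by apply: (core_norm E _ Dy) => h; apply: (proj2 nA).
  - by exists x; split=> // /DA.
  by case: (max Gs').
(* Now the core of [A] is [Gs j] itself, and being open in [A] it has finite index there. *)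
have [N HN] := core_open E scA.
have [l lP] := open_subgroup_reps tg (ex_cpt E) (ball_sub E N) (ball_open E N).
apply: (finite_over_cap tg sA (ball_sub E N)); first by exists l => y _; apply: lP.
by move=> y Ay By; apply: contrapT => nNy; apply: nD; exists y; split=> //; apply: HN.
Qed.

End Existence.

(** * From finite depth to the composition series *)

Lemma expansive_of_finite_depth (G : tgroup) (a : G -> G) :
  is_topgroup G -> tcompact G -> is_aut a -> finite_depth a ->
  exists b V, expansive a b V.
Proof.
move=> tg cpt [ha [ca [b [ab [ba cb]]]]] [V [sV [oV sepV]]].
have [sW oW] := normal_core tg cpt sV oV.
exists b, (fun x => forall g, V (tmul (tmul (tinv g) x) g)); split=> //.
- by move=> x y; rewrite -{1}(ba x) -{1}(ba y) -ha ab.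
- move=> x g Vx h; have := Vx (tmul g h).
  by rewrite !(tgE tg).
- have WV x : (forall g, V (tmul (tmul (tinv g) x) g)) -> V x.
    by move=> /(_ (tone G)); rewrite !(tgE tg).
  move=> x ax bx; apply: sepV => n; last exact/WV/ax.
  by exists (iter n b x); split; [exact/WV/bx | rewrite (iter_cancel _ ba)].
Qed.

Theorem theorem6p20 (G : tgroup) (a : G -> G) :
  is_topgroup G -> hausdorff G -> tcompact G -> is_aut a ->
  topo_transitive a -> finite_depth a ->
  (exists (r : nat) (Gs : nat -> G -> Prop), composition_series a r Gs) /\
  (forall (r : nat) (Gs : nat -> G -> Prop) (s : nat) (Hs : nat -> G -> Prop),
     composition_series a r Gs -> composition_series a s Hs ->
     equivalent_series a r Gs s Hs).
Proof.
move=> tg _ cpt auta tG fd.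
have [b [V E]] := expansive_of_finite_depth tg cpt auta fd.
(* Both halves pass between irreducible quotients and sections of [G] through this equivalence. *)
have irrE K N (hK : subgrp K) (aK : forall x, K x -> K (a x)) :
    stable_closed a b K -> stable_closed a b N -> normal_in N K ->
    irreducible (qaut N hK aK) <-> irreducible_section K N a b.
  move=> sK sN nN.
  apply: (irreducible_quotE tg (sc_sub sN) nN aK (sc_b sK) (sc_a sN) (sc_b sN)
    (ex_homa E) (ex_homb E) (ex_ab E) (ex_ba E)); last exact: sc_closed sK.
  by apply: quot_compact => //; [apply: sc_sub sN | apply: sc_closed sK].
split.
  have [r [Gs [cG max]]] := maximal_chain_ex E tG.
  exists r, Gs; split; last first.
    case=> // j /= jr hK hS; apply/irrE.
    - exact: (st_sc cG jr).
    - exact: (st_sc cG (ltnW jr)).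
    - exact: (st_normal cG jr).
    - exact: (maximal_chain_irreducible E cG max).
  split; first exact: st_bot cG.
  split; first exact: st_top cG.
  split.
    move=> j jr; have sj := st_sc cG jr; split; first by case: sj.
    split; last exact: (st_trans cG jr).
    split; first exact: sc_a sj.
    by move=> y Gy; exists (b y); split; [apply: (sc_b sj) | apply: (ex_ba E)].
  case=> // j /= jr; split; first exact: (st_normal cG jr).
  move=> hK hS; apply: (quot_transitive tg hK (sc_sub (st_sc cG (ltnW jr)))).
  - exact: (sc_a (st_sc cG (ltnW jr))).
  - exact: ex_homa E.
  - exact: (st_trans cG jr).
have chain r Gs : composition_series a r Gs -> irreducible_chain a b r Gs.
  move=> [[bot [top [lev step]]] irr].
  have sc j : j <= r -> stable_closed a b (Gs j).
    move=> /lev [[sj cj] [[aj bj] _]]; split=> // x /bj [y [Gy <-]].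
    by rewrite (ex_ab E).
  have nm j : j < r -> normal_in (Gs j) (Gs j.+1) by move=> jr; case: (step j.+1 jr).
  split=> //; first by move=> x /bot.
  move=> j jr; apply/(irrE _ _ (sc_sub (sc _ jr)) (sc_a (sc _ jr))); last exact: (irr j.+1).
  - exact: sc.
  - by apply: sc; apply: ltnW.
  - exact: nm.
move=> r Gs s Hs /chain cG /chain cH.
exact: (irreducible_chains_equivalent E cG cH).
Qed.
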